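(* Let $q$ be an odd prime power, and in $\mathbb{F}_q^3$ put \[ \mathcal{A}:=\{(0,1,a)^\perp\mid a\in\mathbb{F}_q\}\cup\{(1,a,a^2)^\perp\mid a\in\mathbb{F}_q\},\qquad \mathcal{E}:=\{(1,a,0)^\perp\mid a\in\mathbb{F}_q^\times\}, \] and $\mathcal{D}_{\mathcal{B}}:=\mathcal{A}\cup\mathcal{B}$ for a subset $\mathcal{B}\subseteq\mathcal{E}$. Then: 1. The arrangement $\mathcal{D}_{\mathcal{B}}$ is combinatorially simplicial for every $\mathcal{B}\subseteq\mathcal{E}$. 2. For $\mathcal{B}_1,\mathcal{B}_2\subseteq\mathcal{E}$, the arrangements $\mathcal{D}_{\mathcal{B}_1}$ and $\mathcal{D}_{\mathcal{B}_2}$ are isomorphic under an element of $\mathrm{PGL}_3(\mathbb{F}_q)$ if and only if there exists $z\in\mathbb{F}_q^\times$ such that \[ \mathcal{D}_{\mathcal{B}_1}=\begin{pmatrix}1&0&0\\0&z&0\\0&0&z^2\end{pmatrix}\mathcal{D}_{\mathcal{B}_2}. \] 3. The assignment $z\mapsto \mathrm{diag}(1,z,z^2)$ gives an action of the cyclic group $\mathbb{F}_q^\times$ on $\{\mathcal{D}_{\mathcal{B}}\mid\mathcal{B}\subseteq\mathcal{E}\}$ which preserves isomorphism classes, and with $n:=q-1$ there are exactly \[ \frac{1}{n}\sum_{d\mid n}\varphi\left(\frac{n}{d}\right)2^d \] isomorphism classes (under $\mathrm{PGL}_3(\mathbb{F}_q)$) of arrangements of the form $\mathcal{D}_{\mathcal{B}}$,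 where $\varphi$ is Euler's totient function.
   Context: $(a,b,c)^\perp$ denotes the kernel of the $1\times 3$ matrix $(a\ b\ c)$, a hyperplane of $\mathbb{F}_q^3$ with normal vector $(a,b,c)$. Matrices act on arrangements by acting on the normal vectors (up to scalars) of the hyperplanes: $g$ sends $v^\perp$ to $(gv)^\perp$. An arrangement of hyperplanes is a finite set of hyperplanes in $V=K^r$; it is central if all hyperplanes are linear subspaces, and a central arrangement is essential if the intersection of all its hyperplanes is $0$. The intersection lattice $L(\mathcal{A})$ is the set of all intersections of elements of $\mathcal{A}$ (including $V$ as the empty intersection), ordered by reverse inclusion. The characteristic polynomial is $\chi_{\mathcal{A}}(t)=\sum_{X\in L(\mathcal{A})}\mu(X)t^{\dim X}$, where $\mu(X)=\mu(V,X)$ is the Möbius function of $L(\mathcal{A})$. For $X\in L(\mathcal{A})$ the restriction is $\mathcal{A}^X=\{X\cap H\mid H\in\mathcal{A},\ X\not\subseteq H,\ X\cap H\neq\emptyset\}$, an arrangement in $X$. A finite set $\mathcal{A}$ of hyperplanes in $K^r$ is (combinatorially) simplicial if it is a central, essential arrangement satisfying $r\chi_{\mathcal{A}}(-1)+2\sum_{H\in\mathcal{A}}\chi_{\mathcal{A}^H}(-1)=0$. *)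

(* Defs.v *)
From HB Require Import structures.
From mathcomp Require Import all_boot all_order all_fingroup all_algebra all_solvable finmap.

Set Implicit Arguments.
Unset Strict Implicit.
Unset Printing Implicit Defensive.

Import GRing.Theory.

Local Open Scope fset_scope.
Local Open Scope ring_scope.

(* A hyperplane is a linear subspace here, so every arrangement is central. The
   ambient space is an explicit subspace W, so that a restriction A^X, which
   lives in X, is again an object of the same kind. *)
Section Arrangements.

Variables (K : fieldType) (r : nat).
Implicit Types (W X Y H : {vspace 'cV[K]_r}) (A : {fset {vspace 'cV[K]_r}}).

Definition is_arrangement W A : bool :=
  all (fun H => (H <= W)%VS && ((\dim H).+1 == \dim W)) A.

Definition essential A : bool := (\bigcap_(H <- A) H)%VS == 0%VS.

(* W itself is the intersection of the empty subfamily. *)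
Definition inter_lattice W A : {fset {vspace 'cV[K]_r}} :=
  [fset (W :&: \bigcap_(H <- enum_fset B) H)%VS
     | B : {fset {vspace 'cV[K]_r}} in fpowerset A].

(* mu(W, X) by recursion on the codimension of X in W. The order on the lattice
   is reverse inclusion, so the sum runs over Y strictly containing X. *)
Fixpoint mobius_rec (L : {fset {vspace 'cV[K]_r}}) W (n : nat) X : int :=
  if X == W then 1
  else if n is n'.+1 then
    - \sum_(Y <- L | (X <= Y)%VS && (Y != X)) mobius_rec L W n' Y
  else 0.

Definition mobius W A X : int :=
  mobius_rec (inter_lattice W A) W (\dim W - \dim X) X.

Definition char_poly_arr W A : {poly int} :=
  \sum_(X <- inter_lattice W A) mobius W A X *: 'X^(\dim X).

(* X :&: H is a linear subspace, hence never empty. *)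
Definition restriction A X : {fset {vspace 'cV[K]_r}} :=
  [fset (X :&: H)%VS | H in A & ~~ (X <= H)%VS].

Definition simplicial A : Prop :=
  [/\ is_arrangement fullv A,
      essential A &
      r%:R * (char_poly_arr fullv A).[-1]
        + 2%:R * \sum_(H <- A) (char_poly_arr H (restriction A H)).[-1] = 0].

Lemma inter_lattice_sub W A X : X \in inter_lattice W A -> (X <= W)%VS.
Proof. by case/imfsetP=> B _ ->; apply: capvSl. Qed.

Lemma inter_lattice_top W A : W \in inter_lattice W A.
Proof.
apply/imfsetP; exists fset0; first by rewrite /= fpowersetE fsub0set.
by rewrite big_seq_fset0 capvf.
Qed.

Lemma mobius_rec_stable W A n X :
  X \in inter_lattice W A -> (\dim W - \dim X <= n)%N ->
  mobius_rec (inter_lattice W A) W n X = mobius W A X.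
Proof.
rewrite /mobius; elim: n {-2}n (leqnn n) X => [|m IHm] n le_n X LX le_d.
  by move: le_n le_d; rewrite leqn0 => /eqP->; rewrite leqn0 => /eqP ->.
case: n le_n le_d => [|n] le_n le_d.
  by move: le_d; rewrite leqn0 => /eqP->.
have sXW := inter_lattice_sub LX.
have [-> | neXW] := eqVneq X W; first by rewrite subnn /= !eqxx.
have ltXW : (\dim X < \dim W)%N.
  rewrite ltn_neqAle dimvS // andbT; apply: contra neXW => /eqP eqd.
  by rewrite eqEdim sXW eqd /=.
case def_d: (\dim W - \dim X)%N => [|d] /=.
  by move: ltXW; rewrite -subn_gt0 def_d.
rewrite (negPf neXW); congr (- _).
rewrite big_seq_cond [RHS]big_seq_cond; apply: eq_bigr => Y.
case/and3P=> LY sXY neYX.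
have ltXY : (\dim X < \dim Y)%N.
  rewrite ltn_neqAle dimvS // andbT; apply: contra neYX => /eqP eqd.
  by rewrite eq_sym eqEdim sXY eqd /=.
have le_Yd : (\dim W - \dim Y <= d)%N.
  by rewrite -ltnS -def_d ltn_sub2l.
have le_dn : (d <= n)%N by rewrite -ltnS -def_d.
by rewrite !IHm // ?(leq_trans le_Yd) // ?(leq_trans le_dn).
Qed.

Lemma mobius_top W A : mobius W A W = 1.
Proof. by rewrite /mobius subnn /= eqxx. Qed.

Lemma mobius_sum0 W A X : X \in inter_lattice W A -> X != W ->
  \sum_(Y <- inter_lattice W A | (X <= Y)%VS) mobius W A Y = 0.
Proof.
move=> LX neXW; have sXW := inter_lattice_sub LX.
rewrite big_mkcond (bigD1_seq X) ?fset_uniq //= subvv -big_mkcondr /=.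
rewrite -(@mobius_rec_stable W A (\dim W - \dim X).+1 X LX) //= (negPf neXW).
rewrite addrC; apply/eqP; rewrite subr_eq0; apply/eqP.
rewrite (eq_bigl _ _ (fun Y => andbC _ _)).
rewrite big_seq_cond [RHS]big_seq_cond; apply: eq_bigr => Y /and3P[LY sXY _].
by rewrite mobius_rec_stable // leq_sub2l // dimvS.
Qed.

End Arrangements.

Section Dimension3.

Variable F : finFieldType.
Implicit Types (v : 'cV[F]_3) (A B : {fset {vspace 'cV[F]_3}}).

Definition vec3 (a b c : F) : 'cV[F]_3 := \col_i [:: a; b; c]`_i.

Definition perp v : {vspace 'cV[F]_3} := lker (linfun (mulmx v^T)).

(* g sends v^perp to (g v)^perp, through all normal vectors v of the members
   of A. *)
Definition mx_act (g : 'M[F]_3) A : {fset {vspace 'cV[F]_3}} :=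
  [fset perp (g *m v) | v : 'cV[F]_3 & (v != 0) && (perp v \in A)].

Definition PGL3 : {group coset_of 'Z('GL_3[F])} :=
  ('GL_3[F] / 'Z('GL_3[F]))%G.

Definition PGL3_act (c : coset_of 'Z('GL_3[F])) A : {fset {vspace 'cV[F]_3}} :=
  mx_act (GLval (repr c)) A.

Definition PGL3_iso A B : bool := [exists c in PGL3, A == PGL3_act c B].

Definition arrA : {fset {vspace 'cV[F]_3}} :=
  [fset perp (vec3 0 1 a) | a : F] `|` [fset perp (vec3 1 a (a ^+ 2)) | a : F].

Definition arrE : {fset {vspace 'cV[F]_3}} :=
  [fset perp (vec3 1 a 0) | a : F & a != 0].

Definition arrD B : {fset {vspace 'cV[F]_3}} := arrA `|` B.

Definition familyD : {fset {fset {vspace 'cV[F]_3}}} :=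
  [fset arrD B | B in fpowerset arrE].

Definition iso_classesD : {fset {fset {fset {vspace 'cV[F]_3}}}} :=
  [fset [fset A' in familyD | PGL3_iso A' A] | A in familyD].

Definition diag3 (z : {unit F}) : 'M[F]_3 :=
  diag_mx (vec3 1 (val z) (val z ^+ 2))^T.

Lemma perpP v (x : 'cV[F]_3) : (x \in perp v) = (v^T *m x == 0).
Proof. by rewrite memv_ker lfunE. Qed.

Lemma perpZ (a : F) v : a != 0 -> perp (a *: v) = perp v.
Proof.
move=> nz_a; apply/vspaceP=> x; rewrite !perpP linearZ /= -scalemxAl scaler_eq0.
by rewrite (negPf nz_a).
Qed.

Lemma center_GL3 (z : {'GL_3[F]}) : z \in 'Z('GL_3[F])%g ->
  exists2 a : F, a != 0 & GLval z = a%:M.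
Proof.
case/centerP=> _ cz.
have cdelta (i j : 'I_3) : i != j -> comm_mx (GLval z) (delta_mx i j).
  move=> ne_ij; set M : 'M[F]_3 := 1%:M + delta_mx i j.
  have uM : M \is a GRing.unit.
    apply/unitrP; exists (1%:M - delta_mx i j).
    have dd : delta_mx i j *m delta_mx i j = 0 :> 'M[F]_3.
      by rewrite mul_delta_mx_cond eq_sym (negPf ne_ij) mulr0n.
    rewrite /M -!mulmxE !(mulmxBl, mulmxDl, mulmxBr, mulmxDr) !mul1mx !mulmx1 dd.
    by split; rewrite ?subr0 ?addr0 ?addrK ?subrK.
  pose m : {'GL_3[F]} := FinRing.Unit uM.
  have := congr1 (@GLval 3 F) (cz m (in_setT _)).
  rewrite /GLval /= -!mulmxE /M mulmxDl mulmxDr mul1mx mulmx1.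
  by move/addrI.
have cdelta' (i j : 'I_3) : comm_mx (GLval z) (delta_mx i j).
  have [<- | /cdelta //] := eqVneq i j.
  have [k ne_ki] : exists k : 'I_3, k != i.
    by exists (lift i ord0); rewrite eq_sym neq_lift.
  rewrite -(mul_delta_mx k i i); apply: comm_mxM; apply: cdelta => //.
  by rewrite eq_sym.
have [a def_z] : exists a, GLval z = a%:M.
  exists (GLval z ord0 ord0); apply/matrixP=> i j.
  have /matrixP/(_ i ord0) := cdelta' j ord0.
  rewrite !mxE (bigD1 j) //= big1 => [|k nkj]; last first.
    by rewrite !mxE (negPf nkj) mulr0.
  rewrite (bigD1 ord0) //= big1 => [|k nk0]; last first.
    by rewrite !mxE (negPf nk0) andbF mul0r.
  rewrite !mxE !eqxx mulr1 !addr0 andbT => ->.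
  by case: eqP; rewrite ?mul1r ?mul0r ?mulr1n.
exists a => //; apply/eqP=> a0.
have := GL_unit z; rewrite def_z a0 raddf0 unitr0 //.
Qed.

Lemma PGL3_actE (g : {'GL_3[F]}) A :
  PGL3_act (coset 'Z('GL_3[F])%G g) A = mx_act (GLval g) A.
Proof.
rewrite /PGL3_act.
have Ng : g \in 'N('Z('GL_3[F]))%g.
  by apply: (subsetP (normal_norm (center_normal _))); rewrite inE.
rewrite val_coset //; case: repr_rcosetP => z /center_GL3[a nz_a def_z].
have -> : GLval (z * g)%g = a *: GLval g.
  have -> : GLval (z * g)%g = GLval z *m GLval g by [].
  by rewrite def_z mul_scalar_mx.
by apply: eq_imfset => // v; rewrite /= -scalemxAl perpZ.
Qed.

End Dimension3.

(* Main.v *)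
Require Import Defs.
From mathcomp Require Import all_boot all_order all_fingroup all_algebra all_solvable finmap.
From mathcomp Require Import finfield ring zify.

(** The three parts of the theorem have three different reasons.

    Simpliciality. Over F_q, Moebius inversion shows that chi(q) is the number
    of vectors lying on no hyperplane, while chi(1) = 0. In dimension at most 3
    these two values and the two leading coefficients of chi determine
    chi(-1), so the simplicial equation of an arrangement of n hyperplanes in
    F_q^3 is the point count 3 N0 + 2 N1 = (q^2 - 1)(3 q - n), where N_i is the
    number of vectors lying on exactly i hyperplanes [simplicial_criterion].
    For D_B with |B| = k one has n = 2 q + k and N0 = 0.  A vector (x, y, z)
    lies on the hyperplane of (1, a, a^2) when a is a root of
    x + a y + a^2 z, so the vectors with z != 0 that count for N1 are among
    those with y^2 - 4 x z a nonsquare; since half of the nonzero elements of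
    F_q are nonsquares, 2 N1 = (q^2 - 1)(q - k) [count_mult_eq1].

    Rigidity. Seen as a set of points (x : y : z) of the projective plane, D_B
    is made of the line x = 0 and the conic x z = y^2, both without their point
    of contact (0 : 0 : 1), and of a set of k points (1 : u : 0) on a second
    tangent, with u running through a subset Y of F_q^*.  An isomorphism
    preserves k.  If k <= 1 or k >= q - 2, multiplication by scalars is
    transitive on the subsets with k elements. In the remaining cases x = 0 is
    the only line with exactly q points, so the isomorphism fixes it, fixes
    the point (0 : 0 : 1), and is affine on the chart x = 1, mapping vertical
    lines to vertical lines. The abscissas in Y are those carrying two points,
    hence are mapped to those of the other arrangement. Each of the
    q - k >= 3 other abscissas carries a single point, on the parabola
    z = y^2, and its image is again on the parabola; this forces the whole
    parabola to be preserved. The k >= 2 points (u, 0) then go to points with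
    z = 0, which forces the map to be diag(1, c, c^2) up to a scalar
    [arr_rigid].

    Counting. The arrangements D_B are indexed by the subsets of the cyclic
    group F_q^*, and the isomorphism classes are the orbits of translation on
    these subsets. An element a fixes exactly the unions of cosets of <a>, so
    the Cauchy-Frobenius lemma gives the necklace formula
    [card_necklaces]. *)

Set Implicit Arguments.
Unset Strict Implicit.
Unset Printing Implicit Defensive.

Import GRing.Theory.

Local Open Scope fset_scope.
Local Open Scope ring_scope.

(** * The characteristic polynomial over a finite field *)

Section FiniteFieldMethod.

Variables (F : finFieldType) (r : nat).
Implicit Types (W X Y H : {vspace 'cV[F]_r}) (A : {fset {vspace 'cV[F]_r}}).

Lemma inter_latticeP W A X : reflect
  (exists2 B, B `<=` A & X = (W :&: \bigcap_(H <- B) H)%VS)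
  (X \in inter_lattice W A).
Proof.
apply: (iffP (imfsetP _ _ _ _)) => -[B]; rewrite /= ?fpowersetE => sBA ->;
  by exists B; rewrite //= fpowersetE.
Qed.

Lemma mem_bigcapv (s : seq {vspace 'cV[F]_r}) v :
  (v \in (\bigcap_(H <- s) H)%VS) = all (fun H => v \in H) s.
Proof.
by elim: s => [|H s IHs]; rewrite ?big_nil ?memvf // big_cons memv_cap IHs.
Qed.

Lemma subv_bigcap X (s : seq {vspace 'cV[F]_r}) :
  (X <= \bigcap_(H <- s) H)%VS = all (fun H => X <= H)%VS s.
Proof.
by elim: s => [|H s IHs]; rewrite ?big_nil ?subvf // big_cons subv_cap IHs.
Qed.

Definition off_hyperplanes W A : {set 'cV[F]_r} :=
  [set v | (v \in W) && all (fun H => v \notin H) A].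

(** The finite field method asks for no more than this of the members, and so
    applies to a restriction with no computation of dimensions. *)
Definition proper_members W A := all (fun H => ~~ (W <= H)%VS) A.

(** Among the elements of the lattice that contain v there is a least one X,
    the intersection of the members through v, so the sum runs over all Y
    above X and vanishes by the defining recursion of mu, except when X = W. *)
Lemma sum_mobius_point W A v : proper_members W A -> v \in W ->
  \sum_(X <- inter_lattice W A | v \in X) mobius W A X
    = (all (fun H => v \notin H) A)%:R.
Proof.
move=> /allP pA Wv.
pose B := [fset H in A | v \in H]; pose X := (W :&: \bigcap_(H <- B) H)%VS.
have LX : X \in inter_lattice W A.
  by apply/inter_latticeP; exists B => //; apply/fsubsetP=> H; rewrite !inE => /andP[].
have Xmin Y : Y \in inter_lattice W A -> (v \in Y) = (X <= Y)%VS.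
  case/inter_latticeP=> C sCA ->; apply/idP/idP => [|sXY]; last first.
    apply: (subvP sXY); rewrite memv_cap Wv mem_bigcapv.
    by apply/allP=> H; rewrite !inE => /andP[].
  rewrite memv_cap Wv mem_bigcapv => /allP vC.
  rewrite subv_cap capvSl subv_bigcap; apply/allP=> H CH.
  have: H \in (enum_fset B) by rewrite !inE (fsubsetP sCA) // vC.
  have: (X <= \bigcap_(H <- B) H)%VS by rewrite capvSr.
  by rewrite subv_bigcap => /allP h /h.
rewrite big_seq_cond (eq_bigl (fun Y => (Y \in inter_lattice W A) && (X <= Y)%VS)).
  rewrite -big_seq_cond; have [XW | nXW] := eqVneq X W; last first.
    rewrite mobius_sum0 //; case: allP => // nv; case/eqP: nXW.
    rewrite /X (_ : B = fset0) ?big_seq_fset0 ?capvf //.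
    by apply/fsetP=> H; rewrite !inE; apply/negP=> /andP[/nv/negP].
  rewrite (_ : all _ _ = true); last first.
    apply/allP=> H AH; apply: contra (pA H AH) => vH.
    have: (W <= \bigcap_(H <- B) H)%VS by rewrite -{1}XW capvSr.
    by rewrite subv_bigcap => /allP; apply; rewrite !inE; apply/andP.
  rewrite XW big_mkcond (bigD1_seq W) ?inter_lattice_top ?fset_uniq //= subvv.
  rewrite mobius_top -big_mkcondr big_seq_cond big1 ?addr0 // => Y.
  case/and3P=> LY nYW sWY; case/eqP: nYW; apply/eqP.
  by rewrite eqEsubv sWY (inter_lattice_sub LY).
move=> Y; apply/andP/andP => -[LY]; by rewrite Xmin.
Qed.

(** The finite field method: the left-hand side is chi(q).  As q ^ dim X
    counts the vectors of X, exchange the two summations and apply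
    [sum_mobius_point] to each vector. *)
Lemma sum_mobius_card W A : proper_members W A ->
  \sum_(X <- inter_lattice W A) mobius W A X * (#|F| ^ \dim X)%:R
    = #|off_hyperplanes W A|%:R.
Proof.
move=> pA.
transitivity (\sum_(X <- inter_lattice W A)
  \sum_(v : 'cV[F]_r | v \in X) mobius W A X).
  apply: eq_bigr => X _; rewrite sumr_const -card_vspace mulr_natr.
  by congr (_ *+ _); apply: eq_card => v; rewrite !inE.
rewrite (exchange_big_dep predT) //= -sum1_card natr_sum [RHS]big_mkcond /=.
apply: eq_bigr => v _; rewrite inE; have [Wv | nWv] /= := boolP (v \in W).
  by rewrite sum_mobius_point //; case: all.
rewrite big_seq_cond big1 // => X /andP[LX Xv].
by case/negP: nWv; apply: subvP Xv; apply: inter_lattice_sub LX.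
Qed.

(** This is chi(1) = 0: the whole lattice lies above its bottom element, which
    is not W as soon as there is a hyperplane. *)
Lemma sum_mobius0 W A : proper_members W A -> A != fset0 ->
  \sum_(X <- inter_lattice W A) mobius W A X = 0.
Proof.
move=> /allP pA /fset0Pn[H AH]; pose X := (W :&: \bigcap_(H <- A) H)%VS.
have LX : X \in inter_lattice W A by apply/inter_latticeP; exists A.
have sXH : (X <= H)%VS.
  have: (X <= \bigcap_(H <- A) H)%VS by rewrite capvSr.
  by rewrite subv_bigcap => /allP; apply.
have nXW : X != W by apply: contra (pA H AH) => /eqP <-.
rewrite -[RHS](mobius_sum0 LX nXW) big_seq_cond [RHS]big_seq_cond.
apply: eq_bigl => Y; case LY: (Y \in _) => //=; symmetry.
case/inter_latticeP: LY => B /fsubsetP sBA ->.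
rewrite subv_cap capvSl subv_bigcap; apply/allP=> H' /sBA AH'.
have: (X <= \bigcap_(H <- A) H)%VS by rewrite capvSr.
by rewrite subv_bigcap => /allP; apply.
Qed.

Lemma mobius_hyperplane W A H : H \in inter_lattice W A ->
  (\dim H).+1 = \dim W -> mobius W A H = -1.
Proof.
move=> LH dH; have sHW := inter_lattice_sub LH.
have nHW : H != W by apply/eqP=> eHW; move: dH; rewrite eHW; lia.
have := mobius_sum0 LH nHW.
rewrite big_mkcond (bigD1_seq W) ?inter_lattice_top ?fset_uniq //= sHW.
rewrite mobius_top big_mkcond (bigD1_seq H) ?fset_uniq //= nHW subvv.
rewrite -!big_mkcondr big_seq_cond big1 ?addr0.
  by move/eqP; rewrite addrC addr_eq0 => /eqP.
move=> Y /and3P[LY /andP[nYH nYW] sHY].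
have sYW := inter_lattice_sub LY; exfalso.
have /orP[] : (\dim Y <= \dim H)%N || (\dim W <= \dim Y)%N by lia.
  by move=> dY; case/negP: nYH; rewrite eq_sym eqEdim sHY.
by move=> dY; case/negP: nYW; rewrite eqEdim sYW.
Qed.

Lemma char_poly_arrE W A (x : int) :
  (char_poly_arr W A).[x]
    = \sum_(X <- inter_lattice W A) mobius W A X * x ^+ \dim X.
Proof.
rewrite horner_sum; apply: eq_bigr => X _.
by rewrite hornerZ hornerXn.
Qed.

(** The values of chi at q and at 1 are known, so (-1)^d is interpolated by
    q^d and 1; this is exact for d = 0, 1 up to the factor q - 1, and the last
    two terms correct it for d = 2, 3. *)
Lemma sign_interpolation (q : int) d : (d <= 3)%N ->
  (q - 1) * (-1) ^+ d = - 2 * q ^+ d + (q + 1)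
     + (2 * q ^+ 2 - 2) * (d == 2)%:R + (2 * q ^+ 3 - 2 * q) * (d == 3)%:R.
Proof. by case: d => [|[|[|[|]]]] //= _; ring. Qed.

Lemma char_poly_arrN1 W A : (\dim W <= 3)%N -> proper_members W A -> A != fset0 ->
  let q : int := #|F|%:R in let L := inter_lattice W A in
  (q - 1) * (char_poly_arr W A).[-1] = - 2 * #|off_hyperplanes W A|%:R
     + (2 * q ^+ 2 - 2) * (\sum_(X <- L | \dim X == 2) mobius W A X)
     + (2 * q ^+ 3 - 2 * q) * (\sum_(X <- L | \dim X == 3) mobius W A X).
Proof.
move=> dW pA nA q L; have s0 := sum_mobius0 pA nA.
rewrite char_poly_arrE mulr_sumr -(sum_mobius_card pA) mulr_sumr.
rewrite (big_mkcond (fun X => \dim X == 2)) (big_mkcond (fun X => \dim X == 3)) /=.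
rewrite !mulr_sumr /=.
(* The constant term q + 1 of the interpolation is weighted by chi(1) = 0. *)
rewrite -[RHS]addr0 -[X in _ = _ + X](mulr0 (q + 1)) -[X in _ = _ + _ * X]s0.
rewrite /L mulr_sumr -!big_split /=.
rewrite [LHS]big_seq [RHS]big_seq; apply: eq_bigr => X LX.
have dX : (\dim X <= 3)%N := leq_trans (dimvS (inter_lattice_sub LX)) dW.
rewrite mulrCA sign_interpolation // natrX -/q.
by case: eqP => _; case: eqP => _ /=; ring.
Qed.

Lemma sum_mobius_top W A d : \dim W = d ->
  \sum_(X <- inter_lattice W A | \dim X == d) mobius W A X = 1.
Proof.
move=> <-.
rewrite big_mkcond (bigD1_seq W) ?inter_lattice_top ?fset_uniq //= eqxx.
rewrite mobius_top -big_mkcondr big_seq_cond big1 ?addr0 // => X.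
case/and3P=> LX nXW /eqP dX; case/eqP: nXW; apply/eqP.
by rewrite eqEdim (inter_lattice_sub LX) dX leqnn.
Qed.

Lemma sum_mobius_above W A d : (\dim W < d)%N ->
  \sum_(X <- inter_lattice W A | \dim X == d) mobius W A X = 0.
Proof.
move=> ltWd; rewrite big_seq_cond big1 // => X /andP[LX /eqP dX].
by have := dimvS (inter_lattice_sub LX); rewrite dX leqNgt ltWd.
Qed.

Lemma arrangement_proper W A : is_arrangement W A -> proper_members W A.
Proof.
move=> /allP aA; apply/allP=> H /aA/andP[sHW /eqP dH].
by apply/negP=> /dimvS; rewrite -dH ltnn.
Qed.

(** An intersection of codimension 1 is contained in one of the hyperplanes
    that define it, hence equal to it; so the elements of the lattice that
    contribute are the members of A, each with mu = -1. *)
Lemma sum_mobius_hyperplanes W A d : is_arrangement W A -> \dim W = d.+1 ->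
  \sum_(X <- inter_lattice W A | \dim X == d) mobius W A X = - (#|` A|)%:R.
Proof.
move=> /allP aA dW.
have sAL H : H \in A -> (H \in inter_lattice W A) && (\dim H == d).
  move=> AH; have /andP[sHW /eqP dH] := aA H AH.
  apply/andP; split; last by rewrite -eqSS dH dW.
  apply/inter_latticeP; exists [fset H]; first by rewrite fsub1set.
  by rewrite big_seq_fset1; apply/esym/capv_idPr.
transitivity (\sum_(X <- A) (-1 : int)); last first.
  by rewrite big_const_seq count_predT iter_addr_0 mulNrn.
rewrite -big_filter (perm_big (enum_fset A)) /=.
  rewrite !big_seq; apply: eq_bigr => H /sAL/andP[LH /eqP dH].
  by apply: mobius_hyperplane LH _; rewrite dH.
apply: uniq_perm; rewrite ?filter_uniq ?fset_uniq // => X.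
rewrite mem_filter andbC; apply/idP/idP => [/andP[LX /eqP dX]|]; last exact: sAL.
have [B /fsubsetP sBA defX] := inter_latticeP _ _ _ LX.
have [B0 | [H BH]] := fset_0Vmem B.
  move: defX dX; rewrite B0 big_seq_fset0 capvf => ->; rewrite dW => /eqP.
  by rewrite eqn_leq ltnn.
have sXH : (X <= H)%VS.
  have: (X <= \bigcap_(H <- B) H)%VS by rewrite defX capvSr.
  by rewrite subv_bigcap => /allP; apply.
have /andP[_ /eqP dH] := aA H (sBA H BH).
suff /eqP-> : X == H by apply: sBA.
by rewrite eqEdim sXH dX -ltnS dH dW leqnn.
Qed.

End FiniteFieldMethod.

(** * Simplicial arrangements in dimension 3 *)

Section Rank3.

Variable F : finFieldType.
Implicit Types (H : {vspace 'cV[F]_3}) (A : {fset {vspace 'cV[F]_3}}).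

Definition mult A (v : 'cV[F]_3) := count (fun H => v \in H) A.

Lemma hyperplane_inj A H H' : is_arrangement fullv A -> H \in A -> H' \in A ->
  (H <= H')%VS = (H == H').
Proof.
move=> /allP aA AH AH'; have [_ /eqP dH] := andP (aA _ AH).
have [_ /eqP dH'] := andP (aA _ AH').
by rewrite eqEdim -ltnS dH' -dH leqnn andbT.
Qed.

(** The members of the restriction to H are the intersections of H with the
    other hyperplanes. *)
Lemma off_restriction A H v : is_arrangement fullv A -> H \in A ->
  (v \in off_hyperplanes H (restriction A H)) = (v \in H) && (mult A v == 1%N).
Proof.
move=> aA AH; rewrite inE; case Hv: (v \in H) => //=.
rewrite /mult -size_filter; set s := filter _ _.
have us : uniq s by rewrite filter_uniq ?fset_uniq.
have Hs : H \in s by rewrite mem_filter Hv.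
apply/allP/eqP => [nv | sz1].
  apply/eqP; rewrite -[1%N]/(size [:: H]); apply/eqP/perm_size/uniq_perm => // H'.
  rewrite mem_filter inE; apply/andP/eqP => [[vH' AH'] | -> //].
  apply/eqP/contraT; rewrite eq_sym -(hyperplane_inj aA) // => nHH'.
  have /nv : (H :&: H')%VS \in restriction A H.
    by apply/imfsetP; exists H'; rewrite //= !inE AH'.
  by rewrite memv_cap Hv vH'.
move=> _ /imfsetP[H' /= /[!inE] /andP[AH' nHH'] ->].
rewrite memv_cap Hv /=; apply: contra nHH' => vH'.
have : H' \in s by rewrite mem_filter vH'.
case: s sz1 Hs {us} => [|K []] //= _; rewrite !inE => /eqP -> /eqP ->.
exact: subvv.
Qed.

Lemma sum_card_off_restriction A : is_arrangement fullv A ->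
  (\sum_(H <- A) #|off_hyperplanes H (restriction A H)|
     = #|[set v | mult A v == 1]|)%N.
Proof.
move=> aA; rewrite -[RHS]sum1_card.
transitivity (\sum_(H <- A) \sum_(v | (v \in H) && (mult A v == 1)) 1)%N.
  rewrite !big_seq; apply: eq_bigr => H AH; rewrite -sum1_card.
  by apply: eq_bigl => v; rewrite off_restriction.
rewrite (exchange_big_dep (fun v => mult A v == 1)%N) /=; last first.
  by move=> ? ? _ /andP[].
rewrite [RHS](eq_bigl (fun v => mult A v == 1)%N); last by move=> v; rewrite inE.
apply: eq_bigr => v /eqP v1.
under eq_bigl do rewrite v1 andbT.
by rewrite sum1_count.
Qed.

(** After multiplication by q - 1, [char_poly_arrN1] expresses both chi_A(-1)
    and the chi of each restriction at -1 by point counts.  The counts of the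
    restrictions add up to the number of vectors on exactly one hyperplane, and
    the simplicial equation becomes minus twice the hypothesis. *)
Lemma simplicial_criterion A : let q := #|F| in
  is_arrangement fullv A -> essential A ->
  (3 * #|[set v | mult A v == 0]| + 2 * #|[set v | mult A v == 1]|
     + #|` A| * (q ^ 2 - 1) = 3 * q * (q ^ 2 - 1))%N ->
  simplicial A.
Proof.
move=> q aA eA cnt; split=> //.
have q_gt1 : (1 < q)%N := finNzRing_gt1 F.
have pA := arrangement_proper aA.
have d3 : \dim {: 'cV[F]_3} = 3%N by rewrite dimvf /dim /= muln1.
have nA : A != fset0.
  apply: contraL eA => /eqP->; rewrite /essential big_seq_fset0 -dimv_eq0 d3 //.
have dA H : H \in A -> \dim H = 2%N.
  by move=> /(allP aA)/andP[_ /eqP]; rewrite d3 => -[].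
(* The vanishing of chi at 1 needs a nonempty restriction, so a second member. *)
have two H : H \in A -> exists2 H', H' \in A & ~~ (H <= H')%VS.
  move=> AH; have /allPn[H' AH' nHH'] : ~~ all (fun H' => H <= H')%VS A.
    rewrite -subv_bigcap (eqP eA) subv0 -dimv_eq0 dA //.
  by exists H'.
have chiA : ((q%:R - 1) * (char_poly_arr fullv A).[-1] : int)
    = - 2 * #|[set v | mult A v == 0%N]|%:R
      - (2 * q%:R ^+ 2 - 2) * (#|` A|)%:R + (2 * q%:R ^+ 3 - 2 * q%:R).
  rewrite char_poly_arrN1 ?d3 // sum_mobius_hyperplanes // sum_mobius_top //.
  rewrite mulrN mulr1; congr (_ * _%:R - _ + _).
  apply: eq_card => v; rewrite !inE memvf /= /mult.
  by rewrite -leqn0 leqNgt -has_count -all_predC.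
have chiH H : H \in A ->
  ((q%:R - 1) * (char_poly_arr H (restriction A H)).[-1] : int)
    = - 2 * #|off_hyperplanes H (restriction A H)|%:R + (2 * q%:R ^+ 2 - 2).
  move=> AH; rewrite char_poly_arrN1 ?dA //.
  - rewrite (@sum_mobius_above _ _ _ _ 3) ?dA // sum_mobius_top ?dA //.
    by rewrite mulr0 addr0 mulr1.
  - apply/allP=> _ /imfsetP[H' /= /[!inE] /andP[AH' nHH'] ->].
    by rewrite subv_cap subvv.
  - have [H' AH' nHH'] := two H AH; apply/fset0Pn; exists (H :&: H')%VS.
    by apply/imfsetP; exists H'; rewrite //= !inE AH'.
(* [char_poly_arrN1] computes chi(-1) only up to the factor q - 1. *)
apply: (mulfI (_ : (q%:R - 1 : int) != 0)); first by rewrite subr_eq0; lia.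
rewrite mulr0 mulrDr mulrCA chiA [_ * (2 * _)]mulrCA mulr_sumr big_seq.
rewrite (eq_bigr _ chiH) -big_seq big_split /= -mulr_sumr -natr_sum.
rewrite sum_card_off_restriction // big_const_seq count_predT iter_addr_0.
have : ((3 * #|[set v | mult A v == 0]| + 2 * #|[set v | mult A v == 1]|
     + #|` A| * (q ^ 2 - 1))%N%:R = (3 * q * (q ^ 2 - 1))%N%:R :> int) by rewrite cnt.
rewrite !natrD !natrM natrB ?natrX; last by rewrite expn_gt0; lia.
rewrite -[(_ - 2) *+ _]mulr_natr.
set b := #|_|%:R; set a := #|_|%:R; set c := #|` A|%:R => E.
rewrite [LHS](_ : _ = -2 * (3 * b + 2 * a + c * (q%:R ^+ 2 - 1)
                              - 3 * q%:R * (q%:R ^+ 2 - 1))); last by ring.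
by rewrite -E; ring.
Qed.

End Rank3.

(** * Hyperplanes and normal vectors in coordinates *)

Section Coordinates.

Variable F : finFieldType.
Implicit Types (a b c x y z : F) (u : {unit F}) (X : {set {unit F}}).

Lemma vec3_surj (v : 'cV[F]_3) : v = vec3 (v 0 0) (v 1 0) (v 2%:R 0).
Proof.
apply/matrixP=> i j; rewrite ord1 !mxE.
by case: i => [[|[|[|//]]] lti] /=; congr (v _ _); apply/val_inj.
Qed.

Lemma vec3_inj a b c a' b' c' :
  vec3 a b c = vec3 a' b' c' -> [/\ a = a', b = b' & c = c'].
Proof.
move=> /matrixP E; have := E 0 0; have := E 1 0; have := E 2%:R 0.
by rewrite !mxE.
Qed.

Lemma scale_vec3 k a b c : k *: vec3 a b c = vec3 (k * a) (k * b) (k * c).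
Proof.
by apply/matrixP=> i j; rewrite !mxE; case: i => [[|[|[|//]]] lti].
Qed.

Lemma vec3_eq0 a b c : (vec3 a b c == 0) = [&& a == 0, b == 0 & c == 0].
Proof.
have {1}-> : 0 = vec3 (0 : F) 0 0.
  by apply/matrixP=> i j; rewrite !mxE; case: i => [[|[|[|//]]] lti].
apply/eqP/and3P => [/vec3_inj[-> -> ->] | [/eqP-> /eqP-> /eqP->]] //.
Qed.

Lemma mem_perp a b c x y z :
  (vec3 x y z \in perp (vec3 a b c)) = (a * x + b * y + c * z == 0).
Proof.
rewrite perpP; apply/eqP/eqP => [/matrixP/(_ 0 0) | E].
  by rewrite !mxE !big_ord_recl big_ord0 !mxE /= addr0 addrA.
apply/matrixP=> i j; rewrite !ord1.
by rewrite !mxE !big_ord_recl big_ord0 !mxE /= addr0 addrA.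
Qed.

(** Equal hyperplanes have proportional normal vectors; the 2 x 2 minors are
    tested on (b, -a, 0), (c, 0, -a) and (0, c, -b), which lie on the first
    hyperplane. *)
Lemma perp_sub_minors a b c a' b' c' :
  (perp (vec3 a b c) <= perp (vec3 a' b' c'))%VS ->
  [/\ a * b' = a' * b, a * c' = a' * c & b * c' = b' * c].
Proof.
move=> /subvP sub.
have sub0 x y z : a * x + b * y + c * z = 0 -> a' * x + b' * y + c' * z = 0.
  by move=> E; apply/eqP; rewrite -mem_perp sub // mem_perp E.
split; apply/eqP; rewrite -subr_eq0 -oppr_eq0; apply/eqP.
- by rewrite -[RHS](sub0 b (- a) 0); ring.
- by rewrite -[RHS](sub0 c 0 (- a)); ring.
- by rewrite -[RHS](sub0 0 c (- b)); ring.
Qed.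

Lemma dim_perp (v : 'cV[F]_3) : v != 0 -> \dim (perp v) = 2%N.
Proof.
move=> nv; pose f : 'Hom('cV[F]_3, 'cV[F]_1) := linfun (mulmx v^T).
have dimf : \dim (limg f) = 1%N.
  apply/eqP; rewrite eqn_leq; apply/andP; split.
    by rewrite (leq_trans (dimvS (subvf _))) // dimvf.
  rewrite lt0n dimv_eq0; apply: contra nv => /eqP f0.
  apply/eqP/matrixP => i j; rewrite ord1 mxE.
  have : f (delta_mx i 0) \in limg f by apply: memv_img; rewrite memvf.
  rewrite f0 memv0 lfunE => /eqP/matrixP/(_ 0 0); rewrite !mxE (bigD1 i) //= big1.
    by rewrite !mxE !eqxx mulr1 addr0.
  by move=> k nki; rewrite !mxE (negPf nki) mulr0.
have := limg_ker_dim f fullv; rewrite dimf capfv dimvf /dim /= => E.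
by apply: succn_inj; rewrite -addn1 E.
Qed.

Lemma big_vec3 (R : nmodType) (f : 'cV[F]_3 -> R) :
  \sum_v f v = \sum_z \sum_y \sum_x f (vec3 x y z).
Proof.
rewrite pair_big pair_big /=.
rewrite (reindex (fun p : F * F * F => vec3 p.2 p.1.2 p.1.1)) //=.
exists (fun v : 'cV[F]_3 => (v 2%:R 0, v 1 0, v 0 0)) => [[[z y] x] _ | v _] /=.
  by rewrite !mxE.
by rewrite -vec3_surj.
Qed.

End Coordinates.

(** * Vectors on exactly one hyperplane *)

Section Counting.

Variable F : finFieldType.
Implicit Types (a b c x y z d : F) (u : {unit F}) (X : {set {unit F}}).

Definition normal_vec (t : F + F + {unit F}) : 'cV[F]_3 :=
  match t with
  | inl (inl a) => vec3 0 1 a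
  | inl (inr a) => vec3 1 a (a ^+ 2)
  | inr u => vec3 1 (val u) 0
  end.

(** The labels of D_B are the two copies of F that index the members of the
    fixed part and the units that index B. *)
Definition labels X :=
  [pred t : F + F + {unit F} | if t is inr u then u \in X else true].

(** D_B, where B is given by a subset X of the multiplicative group: this
    makes the family a set of subsets of a cyclic group. *)
Definition arr X : {fset {vspace 'cV[F]_3}} :=
  arrD [fset perp (vec3 1 (val u) 0) | u in X].

Lemma arr_labels X : arr X = [fset perp (normal_vec t) | t in labels X].
Proof.
apply/fsetP=> H; apply/idP/imfsetP => /= [| [[[a|a]|u] /= Xt ->]].
- rewrite !inE => /orP[/orP[]|] /imfsetP[a /= Xa ->].
  + by exists (inl (inl a)).
  + by exists (inl (inr a)).
  + by exists (inr a).
- rewrite !inE; apply/orP; left; apply/orP; left.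
  by apply/imfsetP; exists a.
- rewrite !inE; apply/orP; left; apply/orP; right.
  by apply/imfsetP; exists a.
- rewrite !inE; apply/orP; right.
  by apply/imfsetP; exists u.
Qed.

Lemma unit_neq0 u : FinRing.uval u != 0.
Proof. by have := valP u; rewrite unitfE. Qed.

Lemma normal_vec_neq0 t : normal_vec t != 0.
Proof. by case: t => [[a|a]|u]; rewrite vec3_eq0 oner_eq0 ?andbF. Qed.

Lemma perp_normal_vec_inj : injective (fun t => perp (normal_vec t)).
Proof.
move=> s t /= E; have : (perp (normal_vec s) <= perp (normal_vec t))%VS by rewrite E.
case: s t {E} => [[a|a]|u] [[b|b]|w] /= /perp_sub_minors[];
  rewrite ?mul1r ?mul0r ?mulr0 ?mulr1.
- by move=> _ _ ->.
- by move/eqP; rewrite eq_sym oner_eq0.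
- by move/eqP; rewrite eq_sym oner_eq0.
- by move/eqP; rewrite oner_eq0.
- by move=> ->.
- move=> Ew /esym/eqP; rewrite expf_eq0 /= => /eqP a0.
  by have := unit_neq0 w; rewrite Ew a0 eqxx.
- by move/eqP; rewrite oner_eq0.
- move=> Eu /eqP; rewrite expf_eq0 /= => /eqP b0.
  by have := unit_neq0 u; rewrite -Eu b0 eqxx.
- by move=> /val_inj->.
Qed.

Lemma card_arr X : (#|` arr X| = 2 * #|F| + #|X|)%N.
Proof.
rewrite arr_labels card_imfset /=; last exact: perp_normal_vec_inj.
rewrite -cardE -sum1_card !big_sumType /= !sum1_card cardT -cardE /=.
by rewrite mul2n -addnn.
Qed.

(** The parameters of the members of each family that contain (x, y, z). *)
Definition roots1 y z : {set F} := [set a | y + a * z == 0].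
Definition roots2 x y z : {set F} := [set a | x + a * y + a ^+ 2 * z == 0].
Definition roots3 X x y : {set {unit F}} := [set u in X | x + val u * y == 0].

Lemma mult_arr X x y z :
  mult (arr X) (vec3 x y z) = (#|roots1 y z| + #|roots2 x y z| + #|roots3 X x y|)%N.
Proof.
rewrite /mult -sum1_count arr_labels big_mkcond big_imfset /=; last first.
  by move=> s t _ _; apply: perp_normal_vec_inj.
rewrite big_enum !big_sumType /= -!big_mkcondr /=.
rewrite !sum1_card; congr (_ + _ + _)%N; apply: eq_card => a; rewrite [RHS]inE.
- rewrite -[LHS]/(vec3 x y z \in perp (vec3 0 1 a)) mem_perp.
  by rewrite mul0r mul1r add0r.
- rewrite -[LHS]/(vec3 x y z \in perp (vec3 1 a (a ^+ 2))) mem_perp.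
  by rewrite mul1r.
- rewrite -[LHS]/((a \in X) && (vec3 x y z \in perp (vec3 1 (val a) 0))) mem_perp.
  by rewrite mul1r mul0r addr0.
Qed.

Hypothesis q_odd : odd #|F|.

(** The translation by 1 permutes F, so #|F| is zero in F; for odd #|F| this
    excludes characteristic 2. *)
Lemma two_neq0 : 2%:R != 0 :> F.
Proof.
have q0 : #|F|%:R = 0 :> F.
  have : \sum_(a : F) a = \sum_(a : F) (a + 1) by rewrite (reindex_inj (addIr 1)).
  rewrite big_split /= sumr_const => /eqP.
  by rewrite -[X in X == _]addr0 (inj_eq (addrI _)) eq_sym => /eqP.
apply/eqP=> two0; move: q0; rewrite -(odd_double_half #|F|) q_odd -muln2.
by rewrite natrD natrM two0 mulr0 addr0 => /eqP; rewrite oner_eq0.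
Qed.

Lemma four_neq0 : 4%:R != 0 :> F.
Proof. by rewrite (_ : 4%:R = 2%:R * 2%:R) ?mulf_neq0 ?two_neq0 //; ring. Qed.

Definition nonsquare d : bool := [forall b, b ^+ 2 != d].

Lemma nonsquareP d : reflect (exists b, b ^+ 2 = d) (~~ nonsquare d).
Proof.
rewrite negb_forall; apply: (iffP existsP) => -[b E]; exists b.
  by apply/eqP; rewrite negbK in E.
by rewrite negbK E.
Qed.

Lemma nonsquareM b d : b != 0 -> nonsquare (b ^+ 2 * d) = nonsquare d.
Proof.
move=> nb; apply/negb_inj; apply/nonsquareP/nonsquareP => -[c E].
  by exists (c / b); rewrite exprMn exprVn E; field.
by exists (b * c); rewrite exprMn E.
Qed.

Lemma nonsquare_sqr b : nonsquare (b ^+ 2) = false.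
Proof. by apply/negbTE/nonsquareP; exists b. Qed.

(** A nonzero square has two square roots, 0 has one and a nonsquare none; sum
    the sizes of the fibers of the squaring map. *)
Lemma sum_nonsquare : (2 * (\sum_d nonsquare d) + 1 = #|F|)%N.
Proof.
have fiber d : (#|[set b : F | b ^+ 2 == d]| + 2 * nonsquare d + (d == 0%R) = 2)%N.
  have [nsd | /nonsquareP[b <-]] := boolP (nonsquare d).
    rewrite (_ : d == 0 = false); last first.
      apply: contraTF nsd => /eqP->.
      by rewrite (_ : 0 = 0 ^+ 2) ?nonsquare_sqr ?expr0n.
    rewrite (_ : [set _ | _] = set0) ?cards0 //.
    by apply/setP=> b; rewrite !inE; apply/negbTE/(forallP nsd).
  rewrite muln0 addn0 expf_eq0 /= (_ : [set _ | _] = [set b; -b]).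
    rewrite cards2; case: (eqVneq b (- b)) => [Eb|nEb];
      case: (eqVneq b 0) => [b0|nb0] //=.
      have := two_neq0.
      have /eqP : 2%:R * b = 0 by rewrite mulr_natl mulr2n {2}Eb subrr.
      by rewrite mulf_eq0 (negPf nb0) orbF => ->.
    by rewrite b0 oppr0 eqxx in nEb.
  by apply/setP=> c; rewrite !inE eqf_sqr.
have zero : (\sum_(d : F) (d == 0%R) = 1)%N.
  by rewrite (bigD1 0) //= eqxx big1 // => d /negPf->.
have total : (\sum_d #|[set b : F | b ^+ 2 == d]| = #|F|)%N.
  rewrite -[RHS]sum1_card [RHS](partition_big (fun b : F => b ^+ 2) predT) //=.
  by apply: eq_bigr => d _; rewrite sum1dep_card.
have : (\sum_d (#|[set b : F | b ^+ 2 == d]| + 2 * nonsquare d + (d == 0%R))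
          = 2 * #|F|)%N.
  by rewrite (eq_bigr _ (fun d _ => fiber d)) sum_nat_const mulnC.
rewrite big_split big_split -big_distrr zero total.
set M := (\sum_d nonsquare d)%N => E.
by have {}E : (#|F| + 2 * M + 1 = 2 * #|F|)%N := E; lia.
Qed.

(** Completing the square: a root a corresponds to the square root
    2 a z + y of the discriminant. *)
Lemma roots2_eq0 x y z : z != 0 ->
  (#|roots2 x y z| == 0)%N = nonsquare (y ^+ 2 - 4%:R * x * z).
Proof.
move=> nz; rewrite cards_eq0; have n2 := two_neq0.
apply/negb_inj; apply/set0Pn/nonsquareP => [[a] | [b Eb]].
  rewrite inE => /eqP E; exists (2%:R * a * z + y).
  by rewrite -[RHS](addr0) -[X in _ = _ + X](mulr0 (4%:R * z)) -E; ring.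
exists ((b - y) / (2%:R * z)); rewrite inE; apply/eqP.
have -> : x = (y ^+ 2 - b ^+ 2) / (4%:R * z).
  by rewrite Eb; field; rewrite nz four_neq0.
by field; rewrite nz n2 four_neq0.
Qed.

Lemma card_roots1 y z : z != 0 -> #|roots1 y z| = 1%N.
Proof.
move=> nz; rewrite (_ : roots1 y z = [set - y / z]) ?cards1 //.
apply/setP=> a; rewrite !inE; apply/eqP/eqP => [E|->]; last by field.
by apply: (mulIf nz); rewrite divfK //; apply/eqP; rewrite -addr_eq0 addrC E.
Qed.

(** For z != 0 the vector lies on exactly one member (0, 1, a), so its
    multiplicity is 1 when it lies on no other member. If it avoids all the
    (1, a, a^2), then y != 0 and it lies on at most one (1, u, 0): hence the
    sum over u is 0 or 1. *)
Lemma nonsquare_mult_eq1 X x y z : z != 0 ->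
  (nonsquare (y ^+ 2 - 4%:R * x * z)%R
   = (mult (arr X) (vec3 x y z) == 1) +
     \sum_(u in X) nonsquare (y ^+ 2 - 4%:R * x * z)%R * (x == - val u * y)%R
     :> nat)%N.
Proof.
move=> nz; rewrite mult_arr card_roots1 // -(roots2_eq0 _ _ nz) -addnA add1n eqSS.
rewrite addn_eq0 -big_distrr /=; case: eqP => //= r2; rewrite mul1n.
have -> : (\sum_(u in X) (x == - FinRing.uval u * y)%R = #|roots3 X x y|)%N.
  rewrite -sum1_card -big_mkcondr /=; apply: eq_bigl => u.
  by rewrite inE mulNr -addr_eq0.
suff : (#|roots3 X x y| <= 1)%N by case: #|_| => [|[]].
apply/card_le1_eqP => u w; rewrite !inE => /andP[_ /eqP Eu] /andP[_ /eqP Ew].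
have ny : y != 0.
  apply/eqP=> y0; move/eqP: r2; rewrite roots2_eq0 // y0.
  move: Eu; rewrite y0 mulr0 addr0 => ->.
  by rewrite (_ : _ - _ = 0 ^+ 2) ?nonsquare_sqr //; ring.
apply/val_inj/(mulIf ny)/(addrI x) => /=.
by rewrite Eu Ew.
Qed.

(** On the line x = - k y the discriminant is y^2 (1 + 4 k z / y), so that
    y runs through F^* while 1 + 4 k z / y runs through F minus 1. *)
Lemma sum_nonsquare_line z k : z != 0 -> k != 0 ->
  (\sum_y nonsquare (y ^+ 2 - 4%:R * (- k * y) * z)%R = \sum_d nonsquare d)%N.
Proof.
move=> nz nk; have n4 : 4%:R != 0 :> F by apply: four_neq0.
have inj : injective (fun y : F => 1 + 4%:R * k * z * y^-1).
  move=> a b /addrI/(mulfI _)/invr_inj; apply.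
  by rewrite !mulf_neq0.
rewrite [RHS](reindex_inj inj) /=; apply: eq_bigr => y _; congr nat_of_bool.
(* At y = 0 the discriminant is 0 and, as 0^-1 = 0, the new variable is 1:
   both are squares. *)
have [-> | ny] := eqVneq y 0.
  rewrite invr0 !mulr0 addr0 -[1 in RHS](expr1n F 2) nonsquare_sqr.
  by rewrite (_ : _ - _ = 0 ^+ 2) ?nonsquare_sqr //; ring.
by rewrite -[RHS](nonsquareM _ ny); congr nonsquare; field.
Qed.

(** There are q (q - 1) / 2 pairs (x, y) with a nonsquare discriminant, from
    which each u in X removes the (q - 1) / 2 pairs of its line. *)
Lemma sum_mult_eq1_affine X z : z != 0 ->
  (2 * (\sum_y \sum_x (mult (arr X) (vec3 x y z) == 1)) + #|X| * #|F|.-1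
    = #|F| * #|F|.-1)%N.
Proof.
move=> nz; have M := sum_nonsquare.
have n4 : 4%:R * z != 0 by rewrite mulf_neq0 ?four_neq0.
have : (\sum_y \sum_x nonsquare (y ^+ 2 - 4%:R * x * z)%R
          = #|F| * \sum_d nonsquare d)%N.
  rewrite -sum_nat_const; apply: eq_bigr => y _.
  have inj : injective (fun x : F => y ^+ 2 - 4%:R * x * z).
    move=> a b /addrI/oppr_inj/eqP.
    by rewrite ![_ * _ * z]mulrAC => /eqP/(mulfI n4).
  by rewrite [RHS](reindex_inj inj).
under eq_bigr do under eq_bigr do rewrite (nonsquare_mult_eq1 X _ _ nz).
under eq_bigr do rewrite big_split /= [X in (_ + X)%N]exchange_big /=.
rewrite big_split /= [X in (_ + X)%N]exchange_big /=.
rewrite [X in (_ + X)%N](_ : _ = #|X| * \sum_d nonsquare d)%N.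
  have -> : #|F|.-1 = (2 * \sum_d nonsquare d)%N by lia.
  rewrite addnC ![(_ * (2 * _))%N]mulnCA -mulnDr => <-.
  by rewrite addnC.
rewrite -sum_nat_const; apply: eq_bigr => u _.
rewrite -(sum_nonsquare_line nz (unit_neq0 u)); apply: eq_bigr => y _.
rewrite (bigD1 (- FinRing.uval u * y)) //= eqxx muln1 big1 ?addn0 // => x /negPf->.
by rewrite muln0.
Qed.

(** For z = 0 and y != 0 the only member (1, a, a^2) through the vector has
    a = - x / y, and it is the only member at all unless a is in X; for y = 0
    all the (0, 1, a) pass through the vector. *)
Lemma sum_mult_eq1_infinity X :
  (\sum_y \sum_x (mult (arr X) (vec3 x y 0%R) == 1) = #|F|.-1 * (#|F| - #|X|))%N.
Proof.
rewrite (bigD1 0) //= big1 ?add0n => [|x _]; last first.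
  rewrite mult_arr (_ : roots1 0 0 = setT) ?cardsT; last first.
    by apply/setP=> a; rewrite !inE mulr0 addr0 eqxx.
  by rewrite gtn_eqF // -addnA ltn_addr // finNzRing_gt1.
transitivity (\sum_(y : F | y != 0%R) (#|F| - #|X|))%N; last first.
  by rewrite sum_nat_const; congr (_ * _)%N; rewrite (cardC1 0).
apply: eq_bigr => y ny.
have inj : injective (fun a : F => - a * y) by move=> a b /(mulIf ny)/oppr_inj.
(* Reindex by the root a, so that x = - a y. *)
rewrite (reindex_inj inj) /=.
transitivity (#|~: ([set val u | u in X] : {set F})|)%N; last first.
  by rewrite cardsCs setCK card_imset //; apply: val_inj.
rewrite -sum1_card [RHS]big_mkcond /=; apply: eq_bigr => a _.
rewrite mult_arr (_ : roots1 y 0 = set0) ?cards0; last first.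
  by apply/setP=> b; rewrite !inE mulr0 addr0 (negPf ny).
rewrite (_ : roots2 _ y 0 = [set a]) ?cards1; last first.
  apply/setP=> b; rewrite !inE mulr0 addr0 mulNr addrC subr_eq0.
  by rewrite (inj_eq (mulIf ny)).
rewrite add0n add1n eqSS cards_eq0 inE.
rewrite (_ : (_ == set0) = (a \notin [set val u | u in X])); first by case: ifP.
apply/negb_inj; rewrite negbK; apply/set0Pn/imsetP => [[u] | [u Xu ->]].
  rewrite inE => /andP[Xu]; rewrite mulNr addrC subr_eq0 (inj_eq (mulIf ny)).
  by move=> /eqP <-; exists u.
by exists u; rewrite inE Xu mulNr addrC subrr eqxx.
Qed.

Lemma mult_neq0 X v : mult (arr X) v != 0%N.
Proof.
rewrite [v]vec3_surj; move: (v _ _) (v _ _) (v _ _) => z y x.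
rewrite mult_arr; have [-> | nz] := eqVneq z 0; last first.
  by rewrite (card_roots1 _ nz) -lt0n -addnA.
have [-> | ny] := eqVneq y 0.
  rewrite -lt0n (@leq_trans #|roots1 (0 : F) 0|) // -?addnA ?leq_addr // card_gt0.
  by apply/set0Pn; exists 0; rewrite inE mulr0 addr0.
rewrite -lt0n (@leq_trans #|roots2 x y 0|) // -?addnA ?leq_addr //; last first.
  by rewrite addnCA leq_addr.
rewrite card_gt0; apply/set0Pn; exists (- x / y).
by rewrite inE mulr0 addr0 divfK // subrr.
Qed.

(** The slice z = 0 contributes (q - 1)(q - k), and each of the q - 1 others
    (q - k)(q - 1) / 2. *)
Lemma count_mult_eq1 X :
  (2 * #|[set v | mult (arr X) v == 1]| = (#|F| ^ 2 - 1) * (#|F| - #|X|))%N.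
Proof.
have leX : (#|X| <= #|F|.-1)%N.
  by rewrite -card_finField_unit subset_leq_card ?subsetT.
have := sum_nonsquare; set M := (\sum_d _)%N => qM.
have /subnKC : (#|X| <= #|F|)%N by apply: leq_trans leX (leq_pred _).
move: (_ - _)%N => j Ej.
have E z : z != 0 -> (\sum_y \sum_x (mult (arr X) (vec3 x y z) == 1) = j * M)%N.
  move=> nz; have := sum_mult_eq1_affine X nz.
  rewrite -{2}Ej -qM addn1 /=; set S := (\sum_y _)%N.
  rewrite mulnDl addnC => /addnI; rewrite mulnCA => /eqP.
  by rewrite eqn_pmul2l // => /eqP.
rewrite -sum1dep_card big_mkcond big_vec3 (bigD1 0) //= sum_mult_eq1_infinity.
rewrite (eq_bigr _ E) sum_nat_const (cardC1 0).
rewrite -[X in (2 * X)%N]/(_ + _)%N -{2}Ej addKn.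
change (2 * (#|F|.-1 * j + #|F|.-1 * (j * M)) = (#|F| ^ 2 - 1) * j)%N.
rewrite -qM addn1 /= (_ : ((2 * M).+1 ^ 2 - 1 = 4 * M * (M + 1))%N); nia.
Qed.

Theorem arr_simplicial X : simplicial (arr X).
Proof.
apply: simplicial_criterion.
- apply/allP=> H; rewrite arr_labels => /imfsetP[t _ ->] /=.
  rewrite subvf dim_perp ?normal_vec_neq0 //.
  by rewrite dimvf.
- rewrite /essential -subv0; apply/subvP=> v; rewrite mem_bigcapv.
  move=> /allP vA.
  have vt t : t \in labels X -> v \in perp (normal_vec t).
    by move=> Xt; apply: vA; rewrite arr_labels; apply/imfsetP; exists t.
  (* y = 0, y + z = 0 and x = 0 have only the zero solution. *)
  have := vt (inl (inl 0)) isT; have := vt (inl (inl 1)) isT.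
  have := vt (inl (inr 0)) isT.
  rewrite memv0 [v]vec3_surj; move: (v _ _) (v _ _) (v _ _) => z y x.
  rewrite !mem_perp vec3_eq0 !(mul0r, mul1r, add0r, addr0, expr0n) /=.
  move=> -> /eqP yz /eqP y0.
  by move: yz; rewrite y0 add0r => ->; rewrite !eqxx.
- rewrite count_mult_eq1 card_arr.
  rewrite (_ : [set _ | _] = set0) ?cards0; last first.
    by apply/setP=> v; rewrite !inE (negPf (mult_neq0 X v)).
  have leX : (#|X| <= #|F|.-1)%N.
    by rewrite -card_finField_unit subset_leq_card ?subsetT.
  have q_gt1 : (1 < #|F|)%N := finNzRing_gt1 F.
  rewrite muln0 add0n mulnC -mulnDl.
  by congr (_ * _)%N; lia.
Qed.

End Counting.

(** * The action of matrices *)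

Section Action.

Variable F : finFieldType.
Implicit Types (x y z a : F) (u : {unit F}) (X Y : {set {unit F}}).
Implicit Types (v w : 'cV[F]_3) (g : 'M[F]_3).

(** The hyperplane of g v depends on that of v only, so the action on
    arrangements can be computed on any choice of normal vectors. *)
Lemma perp_mulmx g v : perp (g *m v) = (linfun (mulmx g^T) @^-1: perp v)%VS.
Proof.
apply/vspaceP=> x; rewrite -memv_preim !perpP lfunE /=.
by rewrite trmx_mul mulmxA.
Qed.

Lemma perp_mulmx_inj g v w : g \in unitmx ->
  (perp (g *m v) == perp (g *m w)) = (perp v == perp w).
Proof.
move=> ug; apply/eqP/eqP => E; last by rewrite !perp_mulmx E.
by rewrite -[v](mulKmx ug) -[w](mulKmx ug) [LHS]perp_mulmx E -perp_mulmx.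
Qed.

Lemma mx_act_arr g X :
  mx_act g (arr X) = [fset perp (g *m normal_vec t) | t in labels X].
Proof.
apply/fsetP=> H; apply/imfsetP/imfsetP => /= [[v /andP[nv] ] | [t Xt ->]].
  rewrite arr_labels => /imfsetP[t /= Xt E] ->; exists t => //.
  by rewrite !perp_mulmx E.
exists (normal_vec t) => //; rewrite inE normal_vec_neq0 arr_labels /=.
by apply/imfsetP; exists t.
Qed.

Lemma card_mx_act_arr g X : g \in unitmx ->
  (#|` mx_act g (arr X)| = 2 * #|F| + #|X|)%N.
Proof.
move=> ug; rewrite mx_act_arr -card_arr arr_labels !card_imfset //=.
  exact: perp_normal_vec_inj.
by move=> s t /eqP; rewrite perp_mulmx_inj // => /eqP/perp_normal_vec_inj.
Qed.

Lemma mulmx_vec3 g x y z : g *m vec3 x y z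
  = vec3 (g 0 0 * x + g 0 1 * y + g 0 2%:R * z)
         (g 1 0 * x + g 1 1 * y + g 1 2%:R * z)
         (g 2%:R 0 * x + g 2%:R 1 * y + g 2%:R 2%:R * z).
Proof.
apply/matrixP=> i j; rewrite !mxE !big_ord_recl big_ord0 !mxE /= addr0 addrA.
by case: i => [[|[|[|//]]] lti] /=; congr (g _ _ * _ + g _ _ * _ + g _ _ * _);
  apply/val_inj.
Qed.

Lemma diag3_vec3 u x y z :
  diag3 u *m vec3 x y z = vec3 x (val u * y) (val u ^+ 2 * z).
Proof.
by rewrite mulmx_vec3 !mxE /= !(mulr1n, mulr0n, mul0r, mul1r, addr0, add0r).
Qed.

Lemma mx_act_diag3 u X : mx_act (diag3 u) (arr X) = arr (X :* u)%g.
Proof.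
have nu := unit_neq0 u.
have Ea a : perp (diag3 u *m vec3 0 1 a) = perp (vec3 0 1 (val u * a)).
  by rewrite diag3_vec3 -[RHS](perpZ _ nu) scale_vec3 mulr0 mulr1 mulrA expr2.
have Eb a : perp (diag3 u *m vec3 1 a (a ^+ 2))
              = perp (vec3 1 (val u * a) ((val u * a) ^+ 2)).
  by rewrite diag3_vec3 exprMn.
have Ew (w : {unit F}) :
    perp (diag3 u *m vec3 1 (val w) 0) = perp (vec3 1 (val (w * u)%g) 0).
  by rewrite diag3_vec3 mulr0 /= mulrC.
rewrite mx_act_arr arr_labels; apply/fsetP=> H.
apply/imfsetP/imfsetP => -[[[a|a]|w] /= Xt ->].
- by exists (inl (inl (val u * a))).
- by exists (inl (inr (val u * a))).
- exists (inr (w * u)%g); last exact: Ew.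
  by change ((w * u)%g \in (X :* u)%g); rewrite mem_rcoset mulgK.
- exists (inl (inl ((val u)^-1 * a))) => //.
  by rewrite [RHS]Ea mulrA divff // mul1r.
- exists (inl (inr ((val u)^-1 * a))) => //.
  by rewrite [RHS]Eb mulrA divff // mul1r.
- have : w \in (X :* u)%g := Xt; rewrite mem_rcoset => Xw.
  exists (inr (w * u^-1)%g) => //.
  by rewrite [RHS]Ew mulgKV.
Qed.

Lemma diag3_unit u : diag3 u \in unitmx.
Proof.
have nu := unit_neq0 u.
rewrite unitmxE unitfE det_diag !big_ord_recl big_ord0 !mxE /= mulr1 mul1r.
by rewrite mulf_neq0 ?expf_neq0.
Qed.

Lemma perp_vec3_eq (a b c a' b' c' : F) :
  a = a' -> b = b' -> c = c' -> perp (vec3 a b c) = perp (vec3 a' b' c').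
Proof. by move=> -> -> ->. Qed.

Lemma perp_arr_neq0 v X : perp v \in arr X -> v != 0.
Proof.
rewrite arr_labels => /imfsetP[t _ /= E]; apply/eqP=> v0.
have := dim_perp (normal_vec_neq0 t); rewrite -E v0.
suff -> : perp (0 : 'cV[F]_3) = fullv by rewrite dimvf.
by apply/vspaceP=> w; rewrite memvf perpP trmx0 mul0mx eqxx.
Qed.

(** D_B as a set of projective points: the line x = 0 and the conic
    x z = y^2, both without (0 : 0 : 1), and the points (1 : u : 0). *)
Lemma perp_arr x y z X : reflect
  [\/ x = 0 /\ y != 0, x != 0 /\ x * z = y ^+ 2
    | [/\ x != 0, z = 0 & exists2 u, u \in X & y = val u * x]]
  (perp (vec3 x y z) \in arr X).
Proof.
apply: (iffP idP) => [Xv | ]; last first.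
  rewrite arr_labels => H; apply/imfsetP; move: H.
  case=> [[-> ny] | [nx E] | [nx -> [u Xu ->]]].
  - exists (inl (inl (z / y))) => //=; rewrite -[RHS](perpZ _ ny) scale_vec3.
    by rewrite mulr0 mulr1 mulrC divfK.
  - exists (inl (inr (y / x))) => //=; rewrite -[RHS](perpZ _ nx) scale_vec3.
    rewrite mulr1 [x * (y / x)]mulrC divfK // (_ : x * (y / x) ^+ 2 = z) //.
    by apply: (mulfI nx); rewrite E; field.
  - exists (inr u) => //=; rewrite -[RHS](perpZ _ nx) scale_vec3.
    by rewrite mulr0 mulr1 mulrC.
have := perp_arr_neq0 Xv; move: Xv; rewrite arr_labels => /imfsetP[/= t Xt E] nv.
have : (perp (normal_vec t) <= perp (vec3 x y z))%VS by rewrite E.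
move: nv; rewrite vec3_eq0.
case: t {E} Xt => [[a|a]|u] /= Xt nv /perp_sub_minors[];
  rewrite ?mul1r ?mulr1 ?mul0r => E1 E2 E3.
- apply: Or31; split=> //; apply: contra nv => /eqP y0.
  by rewrite E3 y0 mul0r -E1 !eqxx.
- apply: Or32; split; last by rewrite E2 E1; ring.
  by apply: contra nv => /eqP x0; rewrite E2 E1 x0 !mul0r eqxx.
- apply: Or33; split; first 1 last.
  + by rewrite E2 mulr0.
  + by exists u => //; rewrite E1 mulrC.
  by apply: contra nv => /eqP x0; rewrite E2 E1 x0 !mul0r eqxx.
Qed.

End Action.

(** * Rigidity of the family *)

Section Rigidity.

Variable F : finFieldType.
Implicit Types (x y z a : F) (u : {unit F}) (X Y : {set {unit F}}).
Implicit Types (v w : 'cV[F]_3) (g : 'M[F]_3).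

(** Applied to X or to its complement, this settles the extreme
    cardinalities. *)
Lemma small_sets_translate (gT : finGroupType) (X Y : {set gT}) :
  #|X| = #|Y| -> (#|Y| <= 1)%N -> exists z : gT, X = (Y :* z)%g.
Proof.
move=> EXY; case EY: #|Y| => [|[|]] // _.
  exists 1%g; rewrite mulg1 (cards0_eq EY); apply: cards0_eq.
  by rewrite EXY.
move/eqP: EY (EY); rewrite -{2}EXY => /cards1P[y ->] /eqP/cards1P[x ->].
by exists (y^-1 * x)%g; rewrite mulg_set1 mulKVg.
Qed.

Lemma poly_vanishing (p : {poly F}) (A : {set F}) :
  (size p <= #|A|)%N -> {in A, forall a, p.[a] = 0} -> p = 0.
Proof.
move=> szp pA; apply/eqP; apply: contraTT szp => np.
rewrite -ltnNge cardE; apply: max_poly_roots np _ (enum_uniq _).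
by apply/allP=> a; rewrite mem_enum => /pA/eqP.
Qed.

Lemma Poly_eq0 (s : seq F) i : Poly s = 0 -> s`_i = 0.
Proof. by move/(congr1 (fun p : {poly F} => p`_i)); rewrite coef_Poly coef0. Qed.

Lemma quadratic_vanishing (A : {set F}) (a b c : F) : (3 <= #|A|)%N ->
  {in A, forall y, a + b * y + c * y ^+ 2 = 0} -> [/\ a = 0, b = 0 & c = 0].
Proof.
move=> A3 vA; have p0 : Poly [:: a; b; c] = 0.
  apply: (@poly_vanishing _ A) => [|y Ay]; first by rewrite (leq_trans (size_Poly _)).
  by rewrite horner_Poly /= -[RHS](vA y Ay); ring.
by split; [exact: Poly_eq0 0%N p0 | exact: Poly_eq0 1%N p0 | exact: Poly_eq0 2%N p0].
Qed.

Lemma card_val (X : {set {unit F}}) : #|[set val u | u in X]| = #|X|.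
Proof. by apply: card_imset; apply: val_inj. Qed.

(** The case 2 <= k <= q - 3 of rigidity, in which the geometry determines the
    matrix g. *)
Section MainCase.

Variables (g : 'M[F]_3) (X Y : {set {unit F}}).
Hypotheses (ug : g \in unitmx) (cXY : #|X| = #|Y|).
Hypotheses (Y2 : (2 <= #|Y|)%N) (Y3 : (#|Y| + 3 <= #|F|)%N).
Hypothesis sYX : forall v, perp v \in arr Y -> perp (g *m v) \in arr X.

Lemma mulmx_unit_eq0 v : (g *m v == 0) = (v == 0).
Proof.
apply/eqP/eqP => [E | ->]; last by rewrite mulmx0.
by rewrite -[v](mulKmx ug) E mulmx0.
Qed.

(** The last two columns of g span the image of the plane x = 0. *)
Lemma columns_independent a b :
  a * g 0 1 + b * g 0 2%:R = 0 -> a * g 1 1 + b * g 1 2%:R = 0 ->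
  a * g 2%:R 1 + b * g 2%:R 2%:R = 0 -> a = 0 /\ b = 0.
Proof.
move=> E0 E1 E2; have : g *m vec3 0 a b == 0.
  by rewrite mulmx_vec3 vec3_eq0 !mulr0 !add0r !(mulrC (g _ _)) E0 E1 E2 eqxx.
by rewrite mulmx_unit_eq0 vec3_eq0 => /and3P[_ /eqP-> /eqP->].
Qed.

Lemma infinity_line_image a :
  let x := g 0 1 + a * g 0 2%:R in let y := g 1 1 + a * g 1 2%:R in
  let z := g 2%:R 1 + a * g 2%:R 2%:R in perp (vec3 x y z) \in arr X.
Proof.
have : perp (vec3 0 1 a) \in arr Y by apply/perp_arr/Or31; rewrite oner_eq0.
by move/sYX; rewrite mulmx_vec3 !mulr0 !mulr1 !add0r !(mulrC _ a).
Qed.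

(** The conic x z = y^2 contains no line. If x z - y^2 vanishes on the plane
    spanned by u and w, the vector wx u - ux w, which has x = 0, also has
    y = 0; and it has z = 0 by polarization unless ux = wx = 0. As u and w are
    independent, ux = wx = 0 follows, and then the plane lies in x = y = 0,
    which is too small. *)
Lemma line_not_in_conic (ux uy uz wx wy wz : F) :
  ux * uz = uy ^+ 2 -> ux * wz + wx * uz = 2%:R * uy * wy -> wx * wz = wy ^+ 2 ->
  (forall a b, a * ux + b * wx = 0 -> a * uy + b * wy = 0 ->
     a * uz + b * wz = 0 -> a = 0 /\ b = 0) -> False.
Proof.
move=> Eu Euw Ew ind.
have p0 : wx * uy - ux * wy = 0.
  apply/eqP; rewrite -sqrf_eq0; apply/eqP.
  have -> : (wx * uy - ux * wy) ^+ 2 = wx ^+ 2 * uy ^+ 2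
     - wx * ux * (2%:R * uy * wy) + ux ^+ 2 * wy ^+ 2 by ring.
  by rewrite -Eu -Euw -Ew; ring.
(* The z coordinate of wx u - ux w vanishes when ux or wx is nonzero. *)
have ru : ux * (wx * uz - ux * wz) = 0.
  transitivity (2%:R * wx * (ux * uz - uy ^+ 2)
    - ux * (ux * wz + wx * uz - 2%:R * uy * wy) + 2%:R * uy * (wx * uy - ux * wy)).
    ring.
  by rewrite Eu Euw p0; ring.
have rw : wx * (wx * uz - ux * wz) = 0.
  transitivity (wx * (ux * wz + wx * uz - 2%:R * uy * wy)
    - 2%:R * ux * (wx * wz - wy ^+ 2) + 2%:R * wy * (wx * uy - ux * wy)).
    ring.
  by rewrite Ew Euw p0; ring.
have [[nu | nw] | [u0 w0]] : (ux != 0 \/ wx != 0) \/ ux = 0 /\ wx = 0.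
  by case: (eqVneq ux 0); case: (eqVneq wx 0); auto.
- have [] := ind wx (- ux); last by move=> _ /eqP; rewrite oppr_eq0 (negPf nu).
  + ring.
  + by rewrite -p0; ring.
  + by apply: (mulfI nu); rewrite mulr0 -ru; ring.
- have [] := ind wx (- ux); last by move=> /eqP; rewrite (negPf nw).
  + ring.
  + by rewrite -p0; ring.
  + by apply: (mulfI nw); rewrite mulr0 -rw; ring.
move/esym/eqP: Eu; rewrite u0 mul0r expf_eq0 /= => /eqP uy0.
move/esym/eqP: Ew; rewrite w0 mul0r expf_eq0 /= => /eqP wy0.
have [||| wz0 uz0] := ind wz (- uz); rewrite ?u0 ?w0 ?uy0 ?wy0; try ring.
have [||| _ /eqP] := ind 0 1; rewrite ?w0 ?wy0 ?wz0 ?oner_eq0 //; ring.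
Qed.

(** The image of the line x = 0 is a line with q points in the arrangement.
    On it the quartic x (x z - y^2) z vanishes at q >= 5 parameters, so one of
    its factors vanishes identically: the image lies in x = 0, in the conic,
    or in z = 0.  The conic is excluded by [line_not_in_conic], and the line
    z = 0 because it carries only k + 2 < q points of the arrangement. *)
Lemma infinity_line_stable : g 0 1 = 0 /\ g 0 2%:R = 0.
Proof.
have := columns_independent; have := infinity_line_image.
move: (g 0 1) (g 1 1) (g 2%:R 1) (g 0 2%:R) (g 1 2%:R) (g 2%:R 2%:R).
move=> ux uy uz wx wy wz im ind.
pose c0 := ux * uz - uy ^+ 2; pose c2 := wx * wz - wy ^+ 2.
pose c1 := ux * wz + wx * uz - 2%:R * uy * wy.
have : Poly [:: ux; wx] * Poly [:: c0; c1; c2] * Poly [:: uz; wz] = 0.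
  apply: (@poly_vanishing _ setT) => [|a _].
    have q5 : (5 <= #|[set: F]|)%N.
      by rewrite cardsT; apply: leq_trans Y3; rewrite -[5%N]/(2 + 3)%N leq_add2r.
    apply: leq_trans q5; rewrite (leq_trans (size_polyMleq _ _)) //.
    rewrite -subn1 leq_subLR; apply: (@leq_trans (4 + 2)) => //.
    apply: leq_add (size_Poly [:: uz; wz]).
    rewrite (leq_trans (size_polyMleq _ _)) // -subn1 leq_subLR.
    exact: leq_add (size_Poly [:: ux; wx]) (size_Poly [:: c0; c1; c2]).
  rewrite !hornerM !horner_Poly /= !(mul0r, add0r) ![_ * a + _]addrC ![_ * a]mulrC.
  have -> : c0 + a * (c1 + a * c2)
      = (ux + a * wx) * (uz + a * wz) - (uy + a * wy) ^+ 2 by rewrite /c0 /c1 /c2; ring.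
  have /perp_arr[[-> _] | [_ E] | [_ -> _]] := im a.
  - by rewrite !mul0r.
  - by rewrite E subrr mulr0 mul0r.
  - by rewrite mulr0.
move/eqP; rewrite !mulf_eq0 -orbA => /or3P[] /eqP P0.
- by split; [exact: Poly_eq0 0%N P0 | exact: Poly_eq0 1%N P0].
- exfalso; apply: (line_not_in_conic _ _ _ ind);
    apply/eqP; rewrite -subr_eq0; apply/eqP.
  + exact: Poly_eq0 0%N P0.
  + exact: Poly_eq0 1%N P0.
  + exact: Poly_eq0 2%N P0.
have uz0 : uz = 0 := Poly_eq0 0%N P0; have wz0 : wz = 0 := Poly_eq0 1%N P0.
(* If z vanishes, the image is the line z = 0, where the points are described
   injectively by y / x, with None for x = 0. *)
exfalso; have m0 : ux * wy - wx * uy != 0.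
  apply/eqP=> m0.
  have [||| wx0 /eqP] := ind wx (- ux); rewrite ?uz0 ?wz0; try ring.
    by rewrite -[RHS](oppr0) -m0; ring.
  rewrite oppr_eq0 => /eqP ux0.
  have [||| wy0 _] := ind wy (- uy); rewrite ?uz0 ?wz0 ?ux0 ?wx0; try ring.
  have [||| _ /eqP] := ind 0 1; rewrite ?uz0 ?wz0 ?wx0 ?wy0 ?oner_eq0 //; ring.
pose f a := if ux + a * wx == 0 then None else Some ((uy + a * wy) / (ux + a * wx)).
have inj : injective f.
  move=> a b; rewrite /f; case: eqP => [Ea | /eqP na]; case: eqP => [Eb | /eqP nb] //.
    move=> _; apply/eqP; rewrite -subr_eq0; apply/negPn/negP => nab.
    have wx0 : wx = 0.
      apply: (mulfI nab); rewrite mulr0 -[RHS](subrr (ux + b * wx)) {1}Eb -Ea; ring.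
    by case/eqP: m0; move: Ea; rewrite wx0 mulr0 addr0 => ->; ring.
  move=> [] /eqP; rewrite eqr_div // => /eqP E.
  apply/eqP; rewrite -subr_eq0 -[_ == 0]orbF -(negbTE m0) -mulf_eq0.
  rewrite (_ : _ * (_ - _) = (uy + a * wy) * (ux + b * wx)
                             - (uy + b * wy) * (ux + a * wx)).
    by rewrite E subrr.
  by ring.
have : f @: setT \subset None |: (Some @: (0 |: [set val u | u in X])).
  apply/subsetP=> _ /imsetP[a _ ->]; rewrite in_setU1 /f.
  have [_ | nx] := eqVneq (ux + a * wx) 0; first by [].
  apply/orP; right; apply: imset_f; rewrite in_setU1.
  have /perp_arr[[x0] | [_ /esym/eqP] | [_ _ [u Xu ->]]] := im a.
  - by rewrite x0 eqxx in nx.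
  - by rewrite uz0 wz0 mulr0 addr0 mulr0 expf_eq0 /= => /eqP->; rewrite mul0r eqxx.
  - by rewrite mulfK // imset_f ?orbT.
move/subset_leq_card; rewrite card_imset // cardsT; apply/negP; rewrite -ltnNge.
rewrite cardsU1 card_imset ?cardsU1 ?card_val; last by move=> ? ? [].
apply: leq_trans Y3; rewrite -cXY; move: #|X| => k.
by case: (_ \notin _); case: (_ \notin _); lia.
Qed.

(** On the chart x = 1 the matrix acts by
    (y, z) |-> (al y + be, ep + ga y + de z). Points with the same y keep a
    common abscissa, so al y + be maps the abscissas of Y, which carry the two
    points z = y^2 and z = 0, to those of X. Elsewhere the parabola goes to the
    parabola, and three points determine a quadratic polynomial. *)
Lemma rigid_middle_case : exists z : {unit F}, X = (Y :* z)%g.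
Proof.
have [ux0 wx0] := infinity_line_stable.
(* The points of x = 0 go to points with y != 0, that is, (0 : 0 : 1) is
   fixed. *)
have im a : g 1 1 + a * g 1 2%:R != 0.
  have := infinity_line_image a; rewrite /= ux0 wx0 mulr0 addr0.
  by case/perp_arr=> -[] //; rewrite eqxx.
have uy0 : g 1 1 != 0 by have := im 0; rewrite mul0r addr0.
have wy0 : g 1 2%:R = 0.
  apply/eqP; apply: contraT => nwy; have := im (- g 1 1 / g 1 2%:R).
  by rewrite divfK // subrr eqxx.
have tx0 : g 0 0 != 0.
  apply/eqP=> tx0; have := mulKVmx ug (vec3 1 0 0).
  rewrite [invmx g *m _]vec3_surj mulmx_vec3 tx0 ux0 wx0 !mul0r !addr0.
  by case/vec3_inj=> /esym/eqP; rewrite oner_eq0.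
have wz0 : g 2%:R 2%:R != 0.
  apply/eqP=> wz0; have [||| _ /eqP] := @columns_independent 0 1.
  - by rewrite wx0; ring.
  - by rewrite wy0; ring.
  - by rewrite wz0; ring.
  by rewrite oner_eq0.
pose be := g 1 0 / g 0 0; pose al := g 1 1 / g 0 0.
pose ep := g 2%:R 0 / g 0 0; pose ga := g 2%:R 1 / g 0 0.
pose de := g 2%:R 2%:R / g 0 0.
have nal : al != 0 by rewrite mulf_neq0 ?invr_eq0.
have nde : de != 0 by rewrite mulf_neq0 ?invr_eq0.
have img y z : perp (vec3 1 y z) \in arr Y ->
  ep + ga * y + de * z = (al * y + be) ^+ 2
  \/ ep + ga * y + de * z = 0 /\ al * y + be \in [set val u | u in X].
  move/sYX.
  have -> : perp (g *m vec3 1 y z)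
            = perp (vec3 1 (al * y + be) (ep + ga * y + de * z)).
    rewrite mulmx_vec3 ux0 wx0 wy0 -[RHS](perpZ _ tx0) scale_vec3.
    by apply: perp_vec3_eq; rewrite /al /be /ep /ga /de; field.
  case/perp_arr=> [[/eqP] | [_ E] | [_ -> [u Xu ->]]]; first by rewrite oner_eq0.
    by left; rewrite -E mul1r.
  by right; split=> //; rewrite mulr1 imset_f.
have imC y : ep + ga * y + de * y ^+ 2 = (al * y + be) ^+ 2
  \/ ep + ga * y + de * y ^+ 2 = 0 /\ al * y + be \in [set val u | u in X].
  by apply: img; apply/perp_arr/Or32; rewrite oner_eq0 mul1r.
have imY u : u \in Y -> let a := val u in
  ep + ga * a = (al * a + be) ^+ 2
  \/ ep + ga * a = 0 /\ al * a + be \in [set val u | u in X].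
  move=> Yu a; have := img a 0; rewrite mulr0 addr0; apply.
  by apply/perp_arr/Or33; split; rewrite ?oner_eq0 //; exists u; rewrite ?mulr1.
(* The two points over an abscissa u in Y have distinct images, so they cannot
   both go to the parabola. *)
have distinct u : ep + ga * val u != ep + ga * val u + de * val u ^+ 2.
  by rewrite -subr_eq0 opprD addNKr oppr_eq0 mulf_neq0 ?expf_neq0 ?unit_neq0.
have YtoX u : u \in Y -> al * val u + be \in [set val u | u in X].
  move=> /imY[E|[]//]; have [E' | []//] := imC (val u).
  by case/eqP: (distinct u); apply: etrans E (esym E').
have inj : injective (fun y => al * y + be) by move=> y z /addIr/(mulfI nal).
have imYX : [set al * a + be | a in [set val u | u in Y]] = [set val u | u in X].
  apply/eqP; rewrite eqEcard (card_imset _ inj) !card_val cXY leqnn andbT.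
  by apply/subsetP=> _ /imsetP[_ /imsetP[u Yu ->] ->]; apply: YtoX.
have [|y|Eep Ega Ede] := @quadratic_vanishing (~: [set val u | u in Y])
    (ep - be ^+ 2) (ga - 2%:R * al * be) (de - al ^+ 2).
- by rewrite -(leq_add2l #|Y|) -{2}(card_val Y) cardsC.
- rewrite inE => nYy; have [E | [_]] := imC y.
    by rewrite -[RHS](subrr ((al * y + be) ^+ 2)) -{1}E; ring.
  by rewrite -imYX (mem_imset _ _ inj) (negPf nYy).
(* The image of (u, u^2) is on the parabola, so that of (u, 0), which has the
   same abscissa, is on z = 0. *)
have r0 u : u \in Y -> ep + ga * val u = 0.
  move=> /imY[E | []//]; have := distinct u; rewrite [X in X != _]E => /eqP[].
  apply/eqP; rewrite -subr_eq0; apply/eqP.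
  transitivity (- (ep - be ^+ 2) - (ga - 2%:R * al * be) * val u
                - (de - al ^+ 2) * val u ^+ 2).
    ring.
  by rewrite Eep Ega Ede; ring.
have ga0 : ga = 0.
  have [u [w [Yu Yw nuw]]] := card_gt1P Y2.
  have nd : val u - val w != 0 by rewrite subr_eq0.
  apply: (mulIf nd); rewrite mul0r -[RHS](subrr (ep + ga * val w)).
  by rewrite {1}(r0 w Yw) -(r0 u Yu); ring.
have be0 : be = 0.
  have [u [_ [Yu _ _]]] := card_gt1P Y2.
  have := r0 u Yu; rewrite ga0 mul0r addr0 => ep0; move: Eep; rewrite ep0 sub0r.
  by move/eqP; rewrite oppr_eq0 expf_eq0 => /eqP.
have ual : al \is a GRing.unit by rewrite unitfE.
exists (FinRing.unit F ual); apply/eqP.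
rewrite eq_sym eqEcard card_rcoset cXY leqnn andbT.
apply/subsetP=> u; rewrite mem_rcoset => /YtoX/imsetP[w Xw]; rewrite be0 addr0 => E.
suff -> : u = w by [].
rewrite -[u](mulgKV (FinRing.unit F ual)); apply: val_inj; rewrite -E /=.
by rewrite mulrC.
Qed.

End MainCase.

Theorem arr_rigid g X Y : g \in unitmx -> mx_act g (arr Y) = arr X ->
  exists z : {unit F}, X = (Y :* z)%g.
Proof.
move=> ug E.
have cXY : #|X| = #|Y|.
  by have := card_mx_act_arr Y ug; rewrite E card_arr => /addnI.
have [Y1 | Y2] := leqP #|Y| 1; first exact: small_sets_translate.
have cF : #|[set: {unit F}]| = #|F|.-1 := card_finField_unit F.
have [Y3 | Y3] := leqP (#|Y| + 3)%N #|F|.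
  apply: rigid_middle_case ug cXY Y2 Y3 _ => v Yv; rewrite -E.
  by apply/imfsetP; exists v; rewrite //= inE Yv (perp_arr_neq0 Yv).
have cCY : (#|~: Y| <= 1)%N.
  rewrite -(leq_add2l #|Y|) cardsC -cardsT cF.
  by move: Y3 Y2; case: #|F| => //; lia.
have [|z Ez] := small_sets_translate (X := ~: X) _ cCY.
  by apply/eqP; rewrite -(eqn_add2l #|X|) cardsC cXY cardsC.
exists z; apply: setC_inj; rewrite Ez; apply/setP=> u.
by rewrite mem_rcoset !inE mem_rcoset.
Qed.

End Rigidity.

(** * Orbits of a cyclic group on its subsets *)

Section Necklaces.

Local Open Scope group_scope.

Variable gT : finGroupType.
Hypothesis cG : cyclic [set: gT].
Implicit Types (a : gT) (X : {set gT}).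

(** The elements of order d are the generators of the only subgroup of
    order d. *)
Lemma card_order_cyclic d : (d %| #|[set: gT]|)%N ->
  #|[set a : gT | #[a] == d]| = totient d.
Proof.
have /cyclicP[x Gx] := cG; rewrite Gx -orderE => dvd_d.
have oy : #[x ^+ (#[x] %/ d)] = d.
  by rewrite orderXdiv ?dvdn_div // divnA // mulKn // order_gt0.
rewrite -{2}oy totient_gen; apply: eq_card => a; rewrite !inE /generator.
have := cycle_sub_group dvd_d => /setP/(_ <[a]>%G).
rewrite !inE -Gx subsetT /= => ->.
by rewrite -val_eqE /= eq_sym.
Qed.

(** The subsets fixed by a are the unions of cosets of <a>, that is, the
    preimages of the subsets of the quotient by <a>. *)
Lemma card_translation_fixed a :
  #|[set X : {set gT} | X :* a == X]| = (2 ^ (#|[set: gT]| %/ #[a]))%N.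
Proof.
have abG := cyclic_abelian cG; pose N := <[a]>%G.
have comm x y : x * y = y * x := centsP abG x (in_setT x) y (in_setT y).
have nN : [set: gT] \subset 'N(N) by rewrite sub_abelian_norm ?subsetT.
have -> : (#|[set: gT]| %/ #[a])%N = #|[set: gT] / N|.
  by rewrite card_quotient // -divgS ?subsetT.
rewrite -card_powerset.
rewrite -(card_in_imset (f := fun C : {set coset_of N} => coset N @*^-1 C));
  last first.
  by move=> C D _ _ E; rewrite -(cosetpreK C) /= E cosetpreK.
apply: eq_card => X; rewrite inE; apply/eqP/imsetP => [Xa | [C _ ->]].
  exists (X / N); first by rewrite powersetE quotientS ?subsetT.
  rewrite quotientK ?(subset_trans (subsetT X)) //; apply/eqP; rewrite eqEsubset.
  apply/andP; split.
    by apply/subsetP=> x Xx; apply/mulsgP; exists 1 x; rewrite ?group1 ?mul1g.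
  apply/subsetP=> _ /mulsgP[_ x /cycleP[i ->] Xx ->]; rewrite comm.
  elim: i => [|i IHi]; first by rewrite mulg1.
  by rewrite -Xa mem_rcoset expgSr mulgA mulgK.
apply/setP=> x; have Nx y : y \in 'N(N) by apply: (subsetP nN); rewrite inE.
have E : coset N (x * a^-1) = coset N x.
  apply/rcoset_kercosetP => //.
  by rewrite mem_rcoset (comm _ x^-1) mulKg groupV cycle_id.
have pre y : (y \in coset N @*^-1 C) = (coset N y \in C).
  by apply/morphpreP/idP => [[]|Cy] //; split; rewrite ?Nx.
by rewrite mem_rcoset !pre E.
Qed.

Lemma sum_over_orders (f : nat -> nat) : let n := #|[set: gT]| in
  (\sum_(a : gT) f #[a] = \sum_(d <- divisors n) totient d * f d)%N.
Proof.
move=> n; have n_gt0 : (0 < n)%N := cardG_gt0 _.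
transitivity (\sum_(d <- divisors n) \sum_(a : gT | #[a] == d) f #[a])%N.
  rewrite (exchange_big_dep predT) //=; apply: eq_bigr => a _.
  rewrite -big_filter (perm_big [:: #[a]]) ?big_seq1 //.
  apply: uniq_perm; rewrite ?filter_uniq ?divisors_uniq // => d.
  rewrite mem_filter inE eq_sym; case: eqP => [->|//] /=.
  by rewrite -dvdn_divisors // order_dvdG ?inE.
rewrite !big_seq; apply: eq_bigr => d; rewrite -dvdn_divisors // => dvd_d.
rewrite -(card_order_cyclic dvd_d) -sum_nat_const.
by apply: eq_big => [a | a /eqP->]; rewrite ?inE.
Qed.

Lemma sum_divisors_flip (f : nat -> nat) n : (0 < n)%N ->
  (\sum_(d <- divisors n) f (n %/ d) = \sum_(d <- divisors n) f d)%N.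
Proof.
move=> n_gt0; rewrite -(big_map (fun d => n %/ d)%N predT f); apply: perm_big.
have flip d : d \in divisors n -> (n %/ d)%N \in divisors n.
  by rewrite -!dvdn_divisors //; apply: dvdn_div.
have flipK : {in divisors n, cancel (fun d => n %/ d)%N (fun d => n %/ d)%N}.
  by move=> d; rewrite -dvdn_divisors // => dvd_d; rewrite divnA ?mulKn.
apply: uniq_perm; rewrite ?map_inj_in_uniq ?divisors_uniq //.
  exact: can_in_inj flipK.
move=> d; apply/mapP/idP => [[e /flip ? ->] // | Dd].
by exists (n %/ d)%N; rewrite ?flip ?flipK.
Qed.

(** The Cauchy-Frobenius lemma, with the elements a sorted by their order. *)
Lemma card_necklaces : let n := #|[set: gT]| in
  (#|orbit 'Rs [set: gT] @: [set: {set gT}]| * n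
     = \sum_(d <- divisors n) totient (n %/ d) * 2 ^ d)%N.
Proof.
move=> n; have n_gt0 : (0 < n)%N := cardG_gt0 _.
have actsG : [acts [set: gT], on [set: {set gT}] | 'Rs].
  by apply/actsP=> a _ X; rewrite !inE.
rewrite -(Frobenius_Cauchy actsG).
transitivity (\sum_(a : gT) 2 ^ (n %/ #[a]))%N.
  apply: eq_big => [a | a _]; first by rewrite inE.
  rewrite -card_translation_fixed; apply: eq_card => X.
  by rewrite in_setI in_setT in_set sub1set !in_set /= rcosetE.
transitivity (\sum_(d <- divisors n) totient d * 2 ^ (n %/ d))%N.
  exact: (sum_over_orders (fun d => 2 ^ (n %/ d))%N).
rewrite -[RHS](sum_divisors_flip (fun d => totient (n %/ d) * 2 ^ d)%N) //.
rewrite !big_seq; apply: eq_bigr => d; rewrite -dvdn_divisors // => dvd_d.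
by rewrite divnA ?mulKn.
Qed.

End Necklaces.

(** * Isomorphism classes as orbits *)

Section Classes.

Variable F : finFieldType.
Implicit Types (u z : {unit F}) (X Y : {set {unit F}}).

Lemma arr_inj : injective (@arr F).
Proof.
have mem_arr X u : (u \in X) = (perp (vec3 1 (val u) 0) \in arr X).
  apply/idP/perp_arr => [Xu | [[/eqP] | [_ /esym/eqP] | [_ _ [w Xw]]]].
  - by apply: Or33; split; rewrite ?oner_eq0 //; exists u; rewrite ?mulr1.
  - by rewrite oner_eq0.
  - by rewrite mulr0 expf_eq0 /= (negPf (unit_neq0 u)).
  - by rewrite mulr1 => /val_inj->.
by move=> X Y E; apply/setP=> u; rewrite !mem_arr E.
Qed.

Lemma subset_arrE (B : {fset {vspace 'cV[F]_3}}) : B `<=` arrE F ->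
  exists X, arrD B = arr X.
Proof.
move=> /fsubsetP sBE; exists [set u | perp (vec3 1 (val u) 0) \in B].
rewrite /arr; congr arrD; apply/fsetP=> H; apply/idP/imfsetP => [BH | [u]] /=.
  have /imfsetP[a /= na defH] := sBE H BH.
  have ua : a \is a GRing.unit by rewrite unitfE.
  by exists (FinRing.unit F ua); rewrite //= inE /= -defH.
by rewrite inE => ? ->.
Qed.

Lemma familyDP A : reflect (exists X, A = arr X) (A \in familyD F).
Proof.
apply: (iffP (imfsetP _ _ _ _)) => [[B] | [X ->]] /=.
  by rewrite fpowersetE => /subset_arrE[X EX] ->; exists X.
exists [fset perp (vec3 1 (val u) 0) | u in X] => //; rewrite fpowersetE.
apply/fsubsetP=> _ /imfsetP[u /= Xu ->]; apply/imfsetP; exists (val u) => //=.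
exact: unit_neq0.
Qed.

Lemma PGL3_iso_arrP X Y :
  reflect (exists z, X = (Y :* z)%g) (PGL3_iso (arr X) (arr Y)).
Proof.
apply: (iffP exists_inP) => [[c _ /eqP E] | [z ->]].
  exact: arr_rigid (GL_unitmx (repr c)) (esym E).
pose g : {'GL_3[F]} := FinRing.unit _ (diag3_unit z).
exists (coset 'Z('GL_3[F])%G g); last by rewrite PGL3_actE -mx_act_diag3.
by apply: mem_quotient; rewrite inE.
Qed.

(** The class of arr Y is the image by [arr] of the orbit of Y, and [arr] is
    injective. *)
Lemma card_iso_classesD :
  #|` iso_classesD F| = #|orbit 'Rs%act [set: {unit F}] @: [set: {set {unit F}}]|.
Proof.
pose orb Y := orbit 'Rs%act [set: {unit F}] Y.
pose h (O : {set {set {unit F}}}) : {fset {fset {vspace 'cV[F]_3}}} :=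
  [fset arr X | X in O].
have h_inj : injective h.
  move=> O P /fsetP E; apply/setP=> X; have := E (arr X).
  by rewrite !(mem_imfset _ _ arr_inj).
have class_orbit Y : [fset A' in familyD F | PGL3_iso A' (arr Y)] = h (orb Y).
  apply/fsetP=> A; rewrite !inE.
  apply/andP/imfsetP => /= [[/familyDP[X ->]] | [X]].
    move=> /PGL3_iso_arrP[z ->]; exists (Y :* z)%g => //.
    by apply/orbitP; exists z; rewrite ?inE //= rcosetE.
  move=> /orbitP[z _ <-] ->; split; first by apply/familyDP; exists ('Rs%act Y z).
  by apply/PGL3_iso_arrP; exists z; rewrite /= rcosetE.
rewrite (_ : iso_classesD F = h @` [fset O in orb @: [set: {set {unit F}}]]).
  by rewrite card_imfset //= card_finset.
apply/fsetP=> C; apply/imfsetP/imfsetP => /= -[].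
  move=> _ /familyDP[Y ->] ->; exists (orb Y) => //.
  by rewrite inE imset_f.
move=> O; rewrite inE => /imsetP[Y _ ->] ->; exists (arr Y) => //.
by apply/familyDP; exists Y.
Qed.

End Classes.

Theorem theorem4p2 (F : finFieldType) (q_odd : odd #|F|) :
  [/\ forall B : {fset {vspace 'cV[F]_3}}, B `<=` arrE F -> simplicial (arrD B),
      forall B1 B2 : {fset {vspace 'cV[F]_3}},
        B1 `<=` arrE F -> B2 `<=` arrE F ->
        PGL3_iso (arrD B1) (arrD B2) <->
        exists z : {unit F}, arrD B1 = mx_act (diag3 z) (arrD B2)
    & [/\ cyclic [set: {unit F}],
          forall (z : {unit F}) (A : {fset {vspace 'cV[F]_3}}),
            A \in familyD F ->
            mx_act (diag3 z) A \in familyD F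
            /\ PGL3_iso (mx_act (diag3 z) A) A,
          forall A : {fset {vspace 'cV[F]_3}}, A \in familyD F ->
            mx_act (diag3 1%g) A = A,
          forall (z w : {unit F}) (A : {fset {vspace 'cV[F]_3}}),
            A \in familyD F ->
            mx_act (diag3 (z * w)%g) A = mx_act (diag3 z) (mx_act (diag3 w) A)
        & (#|` iso_classesD F|)%:R =
          (#|F|.-1)%:R^-1 *
          \sum_(d <- divisors #|F|.-1) (totient (#|F|.-1 %/ d) * 2 ^ d)%:R
            :> rat]].
Proof.
have cG : cyclic [set: {unit F}] := field_unit_group_cyclic _.
split.
- by move=> B /subset_arrE[X ->]; apply: arr_simplicial.
- move=> _ _ /subset_arrE[X ->] /subset_arrE[Y ->].
  split=> [/PGL3_iso_arrP[z ->] | [z]]; first by exists z; rewrite mx_act_diag3.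
  by rewrite mx_act_diag3 => /arr_inj->; apply/PGL3_iso_arrP; exists z.
split=> //.
- move=> z _ /familyDP[X ->]; rewrite mx_act_diag3.
  by split; [apply/familyDP; exists (X :* z)%g | apply/PGL3_iso_arrP; exists z].
- by move=> _ /familyDP[X ->]; rewrite mx_act_diag3 mulg1.
- move=> z w _ /familyDP[X ->]; rewrite !mx_act_diag3 -rcosetM.
  by rewrite ((centsP (cyclic_abelian cG)) z (in_setT z) w (in_setT w)).
have n_gt0 : (0 < #|F|.-1)%N by rewrite -card_finField_unit cardG_gt0.
have nz : (#|F|.-1)%:R != 0 :> rat by rewrite Num.Theory.pnatr_eq0 -lt0n.
apply: (mulfI nz); rewrite mulVKf // -natr_sum -natrM card_iso_classesD.
by rewrite -card_finField_unit -(card_necklaces cG) mulnC.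
Qed.
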